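(* Let $f\in L^1(\mathbb{R})$ be a nonnegative density and let $\varphi\in\mathcal{S}(\mathbb{R})$ with $\varphi\ge0$ and $\int_{\mathbb{R}}f(x)\varphi(x)\,dx=1$. Consider the pair $(T_f,\varphi)$ and assume ${}^{(\varphi)}\kappa_2>0$. Define $h:=\varphi f$. Then: (a) $h$ is a probability density with finite moments of all orders. (b) The mean $\mu_h$ and variance $\sigma_h^2$ of $h$ coincide with the first two weak cumulants: $\mu_h={}^{(\varphi)}\kappa_1$ and $\sigma_h^2={}^{(\varphi)}\kappa_2$. (c) The classical characteristic function of $h$ is the weak characteristic function: $\widehat h(t)=\int e^{itx}h(x)\,dx={}^{(\varphi)}\phi(t)$ for all $t\in\mathbb{R}$. (d) Let $Y_1,Y_2,\dots$ be i.i.d. random variables with density $h$ and set $$\bar Z_n=\frac{Y_1+\cdots+Y_n-n\,{}^{(\varphi)}\kappa_1}{\sqrt{n\,{}^{(\varphi)}\kappa_2}}.$$ Then $\bar Z_n$ converges in distribution to $\mathcal{N}(0,1)$: for every $a\in\mathbb{R}$, $P(\bar Z_n\le a)\to\Phi(a)$, where $\Phi$ is the standard normal distribution function.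
   Context: $\mathcal{S}(\mathbb{R})$ is the Schwartz space; $T_f$ is the tempered distribution induced by $f$. The weak characteristic function of $(T_f,\varphi)$ is ${}^{(\varphi)}\phi(t):=\langle T_f,e^{itx}\varphi(x)\rangle=\int e^{itx}\varphi(x)f(x)\,dx$; near $0$, ${}^{(\varphi)}K(t):=\log{}^{(\varphi)}\phi(t)$ is the continuous branch with ${}^{(\varphi)}K(0)=0$, and the weak cumulants are ${}^{(\varphi)}\kappa_n:=i^{-n}\frac{d^n}{dt^n}{}^{(\varphi)}K(t)\big|_{t=0}$. *)

(* Defs.v *)
(* Library: MathComp-Analysis, over an arbitrary [R : realType];
   the complex numbers are [R[i]] from mathcomp-real-closed. *)
From HB Require Import structures.
From mathcomp Require Import all_boot all_order all_algebra.
From mathcomp Require Import finmap complex.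
From mathcomp Require Import all_classical all_reals all_analysis.

Set Implicit Arguments.
Unset Strict Implicit.
Unset Printing Implicit Defensive.

Import Order.TTheory GRing.Theory Num.Theory.
Import numFieldNormedType.Exports.

Local Open Scope classical_set_scope.
Local Open Scope ring_scope.
Local Open Scope complex_scope.

Section ComplexValued.
Variable R : realType.

Definition expC (z : R[i]) : R[i] :=
  (expR (complex.Re z))%:C * (cos (complex.Im z) +i* sin (complex.Im z)).

Definition integralC (g : R -> R[i]) : R[i] :=
  (\int[lebesgue_measure]_x complex.Re (g x)) +i*
  (\int[lebesgue_measure]_x complex.Im (g x)).

(* [R[i]^o] is [R[i]] with the topology of the complex modulus. *)
Definition complex_derive (g : R -> R[i]) (t : R) : R[i] :=
  lim ((fun s : R => (g (s + t) - g t) / s%:C : R[i]^o) @ 0^').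

Definition complex_deriven (n : nat) (g : R -> R[i]) : R -> R[i] := iter n complex_derive g.

End ComplexValued.

Section WeakCumulants.
Variable R : realType.

(* Schwartz functions are taken real-valued: a complex one that is
   nonnegative takes real values only. *)
Definition schwartz (phi : R -> R) : Prop :=
  (forall (n : nat) (x : R), derivable (derive1n n phi) x 1) /\
  (forall k n : nat, exists C : R, forall x : R, `|x ^+ k * derive1n n phi x| <= C).

(* A distribution is represented by its action psi |-> <T, psi>. *)
Definition regular_distribution (f : R -> R) (psi : R -> R[i]) : R[i] :=
  integralC (fun x => psi x * (f x)%:C).

Definition weak_cf (T : (R -> R[i]) -> R[i]) (phi : R -> R) (t : R) : R[i] :=
  T (fun x => expC (0 +i* (t * x)) * (phi x)%:C).

Definition is_log_branch (chi K : R -> R[i]) : Prop :=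
  K 0 = 0 /\
  \forall t \near (0 : R),
    {for t, continuous (K : R -> R[i]^o)} /\ expC (K t) = chi t.

(* The germ at 0 of a continuous logarithm vanishing at 0 is unique, so the
   choice made by [xget] is irrelevant near 0. *)
Definition weak_log_cf (T : (R -> R[i]) -> R[i]) (phi : R -> R) : R -> R[i] :=
  xget (fun=> 0) [set K | is_log_branch (weak_cf T phi) K].

Definition weak_cumulant (T : (R -> R[i]) -> R[i]) (phi : R -> R) (n : nat) :
    R[i] :=
  'i ^- n * complex_deriven n (weak_log_cf T phi) 0.

End WeakCumulants.

Section Densities.
Variable R : realType.
Local Notation mu := (@lebesgue_measure R).

(* Densities are elements of L^1, hence sign conditions hold a.e. *)
Definition probability_density (h : R -> R) : Prop :=
  [/\ measurable_fun setT h,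
      {ae mu, forall x, 0 <= h x} &
      (\int[mu]_x (h x)%:E = 1)%E].

Definition finite_moment (h : R -> R) (k : nat) : Prop :=
  mu.-integrable setT (fun x => (x ^+ k * h x)%:E).

Definition density_mean (h : R -> R) : R := \int[mu]_x (x * h x).

Definition density_variance (h : R -> R) : R :=
  \int[mu]_x ((x - density_mean h) ^+ 2 * h x).

Definition char_fun (h : R -> R) (t : R) : R[i] :=
  integralC (fun x => expC (0 +i* (t * x)) * (h x)%:C).

End Densities.

Section RandomVariables.
Context {R : realType} {d : measure_display} {T : measurableType d}.
Variable P : probability T R.

Definition has_density (X : {RV P >-> R}) (h : R -> R) : Prop :=
  forall A : set R, measurable A ->
    (distribution P X A = \int[lebesgue_measure]_(x in A) (h x)%:E)%E.

Definition mutually_independent (Y : nat -> {RV P >-> R}) : Prop :=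
  forall (J : {fset nat}) (A : nat -> set R),
    (forall i, measurable (A i)) ->
    (P (\bigcap_(i in [set` J]) (Y i @^-1` A i)) =
     \prod_(i <- J) P (Y i @^-1` A i))%E.

End RandomVariables.

(* Main.v *)
(* The cumulants are read off the principal branch of the logarithm: near 0 the
   continuous branch is K = ln (c^2 + s^2) / 2 + i atan (s / c), where c and s
   are the cosine and sine transforms of h = phi f, and these can be
   differentiated under the integral sign because h has all moments.  A branch
   exists, for otherwise the default value 0 of the logarithm would give a zero
   second cumulant.

   The central limit theorem is proved by Lindeberg's replacement method.  By
   independence, E g(S_{k+1}) = E E' g(S_k + X'_k); replacing X_k by a Gaussian
   with the same first two moments costs at most a constant times
   E|X|^3 + E|N|^3 = O(n^(-3/2)), since averaging over a Gaussian preserves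
   second-order Taylor bounds.  After n replacements, the semigroup property
   of Gaussian averages leaves E g(N).  The indicator of ]-oo, a] is finally
   squeezed between two logistic functions. *)
Require Import Defs.
From HB Require Import structures.
From mathcomp Require Import all_boot all_order all_algebra.
From mathcomp Require Import finmap complex.
From mathcomp Require Import all_classical all_reals all_analysis measurable_realfun.
From mathcomp Require Import ring lra.

Set Implicit Arguments.
Unset Strict Implicit.
Unset Printing Implicit Defensive.

Import Order.TTheory GRing.Theory Num.Theory.
Import numFieldNormedType.Exports.

Local Open Scope classical_set_scope.
Local Open Scope ring_scope.
Local Open Scope complex_scope.

(** * Derivatives of complex-valued functions and the branch of the logarithm *)

Section ComplexDerivative.
Context {R : realType}.
Implicit Types (g : R -> R[i]) (K : R -> R[i]).

(** No Gaussian variable is built beside the given ones: the replacement acts on test functions.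
    [gauss_avg s] averages a test function over a centred Gaussian of standard deviation [s], so the
    probability space carries nothing new, and what must be controlled is a Taylor bound with one
    constant along the whole chain of averages. [taylor2] records such a bound without derivatives,
    so it passes through an integral by linearity and monotonicity.

    The test functions dictate the rest. A logistic function has values in [[0, 1]] and satisfies p'
    = p^2 - p, so its derivatives are polynomials in itself, bounded by elementary inequalities. A
    steepness [l] costs [l ^+ 3] in the Taylor constant against an error of order 1 / sqrt n, so [l]
    is fixed by the tolerance before [n] grows.

    The density [h] is nonnegative only almost everywhere, while [has_density] speaks of sets. The
    passage to expectations therefore goes through the uniqueness of the Radon-Nikodym
    derivative. *)

Lemma complex_normr_le (z : R[i]) : `|z| <= (`|complex.Re z| + `|complex.Im z|)%:C.
Proof.
rewrite normc_def lecR -[leRHS]ger0_norm ?addr_ge0// -sqrtr_sqr ler_wsqrtr//.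
rewrite /= sqrrD !real_normK ?num_real// addrAC lerDl mulrn_wge0// mulr_ge0//.
Qed.

Lemma cvg_complex (T : Type) (F : set_system T) (FF : Filter F) (u v : T -> R) (a b : R) :
  u @ F --> a -> v @ F --> b ->
  (fun x => u x +i* v x : R[i]^o) @ F --> (a +i* b : R[i]^o).
Proof.
move=> ua vb; apply/cvgrPdist_le => e; rewrite ltcE/= => /andP[/eqP Ime Ree].
(* In the order of [R[i]], [0 < e] forces [e] to be real, so its real part can be halved as the
   tolerance. *)
have eE : e = (complex.Re e)%:C by case: e Ime Ree => x y /= ->.
have e2 : 0 < complex.Re e / 2 by rewrite divr_gt0.
have /cvgrPdist_le/(_ _ e2) := ua; have /cvgrPdist_le/(_ _ e2) := vb.
apply: filterS2 => x vx ux; rewrite (le_trans (complex_normr_le _))// eE lecR/=.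
by rewrite (le_trans (lerD ux vx))// -splitr.
Qed.

(** [complex_derive] is a bare [lim]; differentiability of both components is what makes its value
    meaningful. Dividing by the real [s] acts componentwise. *)
Lemma complex_deriveE g (t a b : R) :
  is_derive t 1 (fun s : R => complex.Re (g s)) a ->
  is_derive t 1 (fun s : R => complex.Im (g s)) b ->
  complex_derive g t = a +i* b.
Proof.
move=> [da <-] [db <-]; apply: (@cvg_lim R[i]^o); first exact: norm_hausdorff.
set u := fun s : R => _ : R[i]^o.
have -> : u = fun s => (s^-1 *: (complex.Re (g (s *: 1 + t)) - complex.Re (g t))) +i*
    (s^-1 *: (complex.Im (g (s *: 1 + t)) - complex.Im (g t))).
  apply/funext => s; rewrite /u -[(s *: 1)%R]/(s * 1) mulr1.
  case: (g (s + t)) => x1 y1; case: (g t) => x2 y2 /=.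
  rewrite -[(s%:C)^-1]fmorphV/=.
  by apply/eqP; rewrite eq_complex/=; apply/andP; split; apply/eqP; rewrite /GRing.scale/=; ring.
exact: cvg_complex.
Qed.

(* Near [0] a branch of the logarithm stays in the strip [|Im| < pi/2], where
   it is the principal one. *)
Lemma log_branchE chi K : is_log_branch chi K ->
  \forall t \near (0 : R),
    K t = (ln (complex.Re (chi t) ^+ 2 + complex.Im (chi t) ^+ 2) / 2) +i*
          atan (complex.Im (chi t) / complex.Re (chi t)).
Proof.
move=> [K0 Knear].
have [cK _] := nbhs_singleton Knear.
have pi20 : 0 < pi / 2 :> R by rewrite divr_gt0 ?pi_gt0.
have pi2C : 0 < (pi / 2)%:C :> R[i] by rewrite ltcR.
have /cvgrPdist_lt/(_ _ pi2C) := cK; rewrite K0.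
move: Knear; apply: filterS2 => t [_ expK]; rewrite sub0r normrN => Kt.
have ImK : `|complex.Im (K t)| < pi / 2.
  rewrite -ltcR (le_lt_trans _ Kt)//.
  case: (K t) => x y; rewrite normc_def lecR/= -sqrtr_sqr ler_wsqrtr// lerDr sqr_ge0//.
rewrite -expK /expC /=; case: (K t) ImK => x y /= yp.
have cy : 0 < cos y by rewrite cos_gt0_pihalf// -ltr_norml.
(* With [K t] = x + iy, the squared modulus is e^(2x) and the quotient is tan y; in the strip [atan]
   undoes [tan]. *)
rewrite !mul0r subr0 addr0 !exprMn -mulrDr cos2Dsin2 mulr1 -expRM_natl expRK.
rewrite -mulf_div divff ?gt_eqF ?expR_gt0// mul1r -[sin y / _]/(tan y) tanK.
  by rewrite mulrAC mulfV ?mul1r// pnatr_eq0.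
by rewrite in_itv/= -ltr_norml.
Qed.


(** These are the real and imaginary parts of chi' / chi = conj(chi) chi' / |chi|^2. Positivity of
    [c 0] keeps [c] positive near 0, so that [s / c] may be differentiated. *)
Lemma log_branch_derive chi K (c s c1 s1 : R -> R) :
  is_log_branch chi K -> (forall t, chi t = c t +i* s t) ->
  (forall t : R, is_derive t 1 c (c1 t)) -> (forall t : R, is_derive t 1 s (s1 t)) ->
  0 < c 0 ->
  \forall t \near (0 : R), complex_derive K t =
    ((c t * c1 t + s t * s1 t) / (c t ^+ 2 + s t ^+ 2)) +i*
    ((s1 t * c t - s t * c1 t) / (c t ^+ 2 + s t ^+ 2)).
Proof.
(* Differentiating at [t] needs the formula for [K] around [t], not only at [t]; [nbhs_interior]
   provides this for all [t] near 0. *)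
move=> /log_branchE/nbhs_interior KE chiE dc ds c0.
have /cvgr_gt/(_ _ c0) : {for 0, continuous c}.
  exact/differentiable_continuous/derivable1_diffP.
move: KE; apply: filterS2 => t KE ct.
have r0 : 0 < c t ^+ 2 + s t ^+ 2 by rewrite ltr_wpDr ?sqr_ge0 ?exprn_gt0.
apply: complex_deriveE.
  apply: (@near_eq_is_derive _ _ _ (fun u => 2^-1 * ln (c u * c u + s u * s u))).
    by move: KE; apply: filterS => u ->; rewrite chiE/= mulrC !expr2.
  have dr : is_derive t 1 (fun u => c u * c u + s u * s u)
      (2 * (c t * c1 t + s t * s1 t)).
    apply: is_derive_eq; rewrite /GRing.scale/=; ring.
  have dln : is_derive (c t * c t + s t * s t) 1 (@ln R) (c t * c t + s t * s t)^-1.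
    by apply: is_derive1_ln; rewrite -!expr2.
  have dln' := @is_derive1_comp R (@ln R) (fun u => c u * c u + s u * s u) t _ _ dln dr.
  have -> : (fun u => 2^-1 * ln (c u * c u + s u * s u)) =
     2^-1 \*: (@ln R \o (fun u => c u * c u + s u * s u)) by [].
  apply: is_derive_eq; rewrite /GRing.scale/=; field.
  by rewrite gt_eqF.
apply: (@near_eq_is_derive _ _ _ (fun u => atan (s u * (c u)^-1))).
  by move: KE; apply: filterS => u ->; rewrite chiE.
have dq : is_derive t 1 (fun u => s u * (c u)^-1) ((s1 t * c t - s t * c1 t) / c t ^+ 2).
  have dV := @is_deriveV _ c t (c1 t) 1 (lt0r_neq0 ct) (dc t).
  apply: is_derive_eq; rewrite /GRing.scale/=; field.
  by rewrite gt_eqF.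
have dat := @is_derive1_comp R atan (fun u => s u * (c u)^-1) t _ _
  (is_derive1_atan (s t * (c t)^-1)) dq.
apply: is_derive_eq; field.
by rewrite !gt_eqF.
Qed.

(** This is K'' = chi'' / chi - (chi' / chi)^2 at 0, where chi = 1 and chi' = i [s1 0] by the
    normalisation. *)
Lemma log_branch_derive2 chi K (c s c1 s1 : R -> R) (c2 s2 : R) :
  is_log_branch chi K -> (forall t, chi t = c t +i* s t) ->
  (forall t : R, is_derive t 1 c (c1 t)) -> (forall t : R, is_derive t 1 s (s1 t)) ->
  is_derive (0 : R) 1 c1 c2 -> is_derive (0 : R) 1 s1 s2 ->
  c 0 = 1 -> s 0 = 0 -> c1 0 = 0 ->
  complex_deriven 1 K 0 = 0 +i* s1 0 /\
  complex_deriven 2 K 0 = (c2 + s1 0 ^+ 2) +i* s2.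
Proof.
move=> KE chiE dc ds dc1 ds1 c0 s0 c10.
have dK := log_branch_derive KE chiE dc ds.
rewrite c0 in dK; have {}dK := dK ltr01; split.
  rewrite /complex_deriven/= (nbhs_singleton dK) c0 s0 c10.
  by rewrite !(mul0r,mulr0,add0r,addr0,subr0,expr1n,mulr1,divr1,expr0n)/=.
have r0 : c 0 * c 0 + s 0 * s 0 != 0 by rewrite c0 s0 mulr1 mulr0 addr0 oner_eq0.
have dr : is_derive (0 : R) 1 (fun u => c u * c u + s u * s u) 0.
  apply: is_derive_eq; rewrite /GRing.scale/= c0 s0 c10; ring.
have dV := @is_deriveV _ _ 0 0 1 r0 dr.
rewrite /complex_deriven/=; apply: complex_deriveE.
  apply: (@near_eq_is_derive _ _ _
      (fun t => (c t * c1 t + s t * s1 t) * (c t * c t + s t * s t)^-1)).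
    by move: dK; apply: filterS => u -> /=; rewrite !expr2.
  apply: is_derive_eq; rewrite /GRing.scale/= c0 s0 c10; by field.
apply: (@near_eq_is_derive _ _ _
    (fun t => (s1 t * c t - s t * c1 t) * (c t * c t + s t * s t)^-1)).
  by move: dK; apply: filterS => u -> /=; rewrite !expr2.
apply: is_derive_eq; rewrite /GRing.scale/= c0 s0 c10; by field.
Qed.

End ComplexDerivative.

(** * Differentiation under the integral sign *)

Lemma is_derive_Rintegral d (T : measurableType d) (R : realType)
    (mu : {measure set T -> \bar R}) (F dF : R -> T -> R) (G : T -> R) (u v t : R) :
  u < t < v ->
  (forall x, u < x < v -> mu.-integrable setT (EFin \o F x)) ->
  (forall x y, u < x < v -> is_derive x 1 (F ^~ y) (dF x y)) ->
  mu.-integrable setT (EFin \o G) ->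
  (forall x y, u < x < v -> `|dF x y| <= G y) ->
  is_derive t 1 (fun x => \int[mu]_y F x y) (\int[mu]_y dF t y).
Proof.
move=> tuv iF dFE iG FG.
have It : `]u, v[%classic t by rewrite /= in_itv.
have I x : `]u, v[%classic x -> u < x < v by rewrite /= in_itv.
have G0 y : 0 <= G y by apply: le_trans (FG t y tuv).
have pE x y : u < x < v -> partial1of2 F x y = dF x y.
  by move=> /dFE H; rewrite partial1of2E; have [_ ->] := H y.
have dF' x y : `]u, v[%classic x -> setT y -> derivable (F ^~ y) x 1.
  by move=> /I/dFE H _; have [] := H y.
have FG' x y : `]u, v[%classic x -> setT y -> `|partial1of2 F x y| <= G y.
  by move=> /I xuv _; rewrite pE// FG.
have iF' x : `]u, v[%classic x -> mu.-integrable setT (EFin \o F x) by move=> /I/iF.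
apply: DeriveDef.
  exact: (derivable_under_integral measurableT It iF' dF' G0 iG FG').
rewrite -derive1E (differentiation_under_integral measurableT It iF' dF' G0 iG FG').
by apply: eq_Rintegral => y _; rewrite pE.
Qed.

Section TrigIntegrals.
Context {R : realType}.
Local Notation mu := (@lebesgue_measure R).
Variable h : R -> R.
Hypothesis ih : forall k, finite_moment h k.

Lemma integrable_bounded_moment (b : R -> R) k :
  measurable_fun setT b -> (forall x, `|b x| <= 1) ->
  mu.-integrable setT (fun x => (b x * (x ^+ k * h x))%:E).
Proof.
move=> mb b1; apply: le_integrable (ih k) => //.
  have /measurable_EFinP mh := measurable_int _ (ih k).
  by apply/measurable_EFinP; exact: measurable_funM.
by move=> x _; rewrite !abse_EFin lee_fin normrM ler_piMl.
Qed.

Lemma measurable_comp_scale (b : R -> R) t :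
  measurable_fun [set: R] b -> measurable_fun [set: R] (fun x => b (t * x)).
Proof. by move=> mb; apply: measurableT_comp => //; exact: measurable_funM. Qed.

(* Covers the sine and the cosine, and both derivatives of each. *)
Lemma is_derive_trig_moment (b db : R -> R) k (t : R) :
  (forall x : R, is_derive x 1 b (db x)) ->
  measurable_fun [set: R] b ->
  (forall x, `|b x| <= 1) -> (forall x, `|db x| <= 1) ->
  is_derive t 1 (fun t => \int[mu]_x (b (t * x) * (x ^+ k * h x)))
    (\int[mu]_x (db (t * x) * (x ^+ k.+1 * h x))).
Proof.
move=> dbE mb b1 db1.
apply: (@is_derive_Rintegral _ _ R mu (fun t x => b (t * x) * (x ^+ k * h x))
  (fun t x => db (t * x) * (x ^+ k.+1 * h x)) (fun x => `|x ^+ k.+1 * h x|) (t - 1) (t + 1)).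
- by rewrite ltrBlDr ltrDl ltr01.
- by move=> x _; apply: integrable_bounded_moment => //; exact: measurable_comp_scale.
- move=> s x _.
  have dm : is_derive s 1 (fun u => u * x) x by apply: is_derive_eq; rewrite /GRing.scale/=; ring.
  have dc := @is_derive1_comp R b (fun u => u * x) s _ _ (dbE (s * x)) dm.
  have -> : (fun u => b (u * x) * (x ^+ k * h x)) = (b \o (fun u => u * x)) * cst (x ^+ k * h x) by [].
  by apply: is_derive_eq; rewrite /GRing.scale/= exprS; ring.
- exact: (integrable_norm (ih k.+1)).
- by move=> s x _; rewrite normrM ler_piMl.
Qed.
End TrigIntegrals.

(** * Weak cumulants of a density *)

Section WeakCumulantsOfDensity.
Context {R : realType}.
Local Notation mu := (@lebesgue_measure R).
Variables f phi : R -> R.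
Let h x := phi x * f x.

Lemma char_fun_weak_cf t : char_fun h t = weak_cf (regular_distribution f) phi t.
Proof.
rewrite /char_fun /weak_cf /regular_distribution.
by congr integralC; apply/funext => x; rewrite -mulrA /h rmorphM.
Qed.

Lemma weak_cfE t : weak_cf (regular_distribution f) phi t =
  (\int[mu]_x (cos (t * x) * h x)) +i* (\int[mu]_x (sin (t * x) * h x)).
Proof.
rewrite -char_fun_weak_cf /char_fun /integralC; congr (_ +i* _);
  by apply: eq_Rintegral => x _; rewrite /expC/= expR0; ring.
Qed.

(** The Schwartz bound for the power [k] and the derivative of order 0 dominates the integrand by a
    constant times |f|. *)
Lemma finite_moment_schwartz k :
  f \in Lfun mu 1%E -> schwartz phi -> finite_moment h k.
Proof.
move=> /Lfun1_integrable fi [dphi phib].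
have cphi : continuous phi.
  by move=> x; apply/differentiable_continuous/derivable1_diffP; exact: (dphi 0%N).
have mphi : measurable_fun [set: R] phi by exact: continuous_measurable_fun.
have mf : measurable_fun [set: R] f by apply/measurable_EFinP; exact: measurable_int fi.
have [C phiC] := phib k 0%N.
have C0 : 0 <= C by apply: le_trans (phiC 0).
rewrite /finite_moment.
apply: (@le_integrable _ _ R mu setT measurableT _ (fun x => C%:E * (EFin \o f) x)%E) => //.
- apply/measurable_EFinP; apply: measurable_funM; first exact: measurable_funX.
  exact: measurable_funM.
- move=> x _; rewrite /= !lee_fin /h mulrA !normrM (ger0_norm C0) ler_wpM2r//.
  by rewrite -normrM; exact: phiC.
- exact: integrableZl.
Qed.

Hypothesis ih : forall k, finite_moment h k.
Hypothesis h1 : (\int[mu]_x (h x)%:E = 1)%E.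

Let m k := \int[mu]_x (x ^+ k * h x).

Let cE k (t : R) : is_derive t 1 (fun t => \int[mu]_x (cos (t * x) * (x ^+ k * h x)))
    (\int[mu]_x (- sin (t * x) * (x ^+ k.+1 * h x))).
Proof.
apply: (@is_derive_trig_moment _ _ ih (@cos R) (fun x => - sin x)).
- by apply: continuous_measurable_fun; exact: continuous_cos.
- by move=> x; exact: cos_max.
- by move=> x; rewrite normrN; exact: sin_max.
Qed.

Let sE k (t : R) : is_derive t 1 (fun t => \int[mu]_x (sin (t * x) * (x ^+ k * h x)))
    (\int[mu]_x (cos (t * x) * (x ^+ k.+1 * h x))).
Proof.
apply: (@is_derive_trig_moment _ _ ih (@sin R) (@cos R)).
- by apply: continuous_measurable_fun; exact: continuous_sin.
- by move=> x; exact: sin_max.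
- by move=> x; exact: cos_max.
Qed.

Let int0 (F : R -> R) : (forall x, F x = 0) -> \int[mu]_x F x = 0.
Proof. by move=> F0; rewrite /Rintegral integral0_eq// => x _; rewrite F0. Qed.

(** The transforms give chi'(0) = i [m 1] and chi''(0) = - [m 2]. *)
Lemma weak_cumulants K :
  is_log_branch (weak_cf (regular_distribution f) phi) K ->
  complex_deriven 1 K 0 = 0 +i* m 1 /\
  complex_deriven 2 K 0 = (m 1 ^+ 2 - m 2) +i* 0.
Proof.
move=> KE.
(* The factor [x ^+ 0] keeps these transforms in the shape that [cE] and [sE] differentiate. *)
pose c t := \int[mu]_x (cos (t * x) * (x ^+ 0 * h x)).
pose s t := \int[mu]_x (sin (t * x) * (x ^+ 0 * h x)).
pose c1 t := \int[mu]_x (- sin (t * x) * (x ^+ 1 * h x)).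
pose s1 t := \int[mu]_x (cos (t * x) * (x ^+ 1 * h x)).
have c1E : c1 = - (fun t => \int[mu]_x (sin (t * x) * (x ^+ 1 * h x))).
  apply/funext => t.
  transitivity (- 1 * \int[mu]_x (sin (t * x) * (x ^+ 1 * h x))); last by rewrite mulN1r.
  rewrite -RintegralZl//.
    by apply: eq_Rintegral => x _; rewrite mulN1r mulNr.
  apply: integrable_bounded_moment => //; last by move=> x; exact: sin_max.
  apply: (@measurable_comp_scale R (@sin R)); apply: continuous_measurable_fun.
  exact: continuous_sin.
have dc1 : is_derive (0 : R) 1 c1 (- m 2).
  have := sE 1 0; rewrite c1E => dE; apply: is_derive_eq; congr (- _).
  by apply: eq_Rintegral => x _; rewrite mul0r cos0 mul1r.
have ds1 : is_derive (0 : R) 1 s1 0.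
  have dE := cE 1 0; apply: is_derive_eq.
  apply: int0 => x.
  by rewrite mul0r sin0 oppr0 mul0r.
have s1m : s1 0 = m 1 by apply: eq_Rintegral => x _; rewrite mul0r cos0 mul1r.
have [] := @log_branch_derive2 R _ K c s c1 s1 (- m 2) 0 KE _ (cE 0) (sE 0) dc1 ds1.
- move=> t; rewrite weak_cfE; congr (_ +i* _);
  by apply: eq_Rintegral => x _; rewrite expr0 mul1r.
- transitivity (\int[mu]_x h x); last by rewrite /Rintegral h1.
  by apply: eq_Rintegral => x _; rewrite mul0r cos0 !mul1r.
- apply: int0 => x.
  by rewrite mul0r sin0 mul0r.
- apply: int0 => x.
  by rewrite mul0r sin0 oppr0 mul0r.
by rewrite s1m => -> ->; split=> //; rewrite addrC.
Qed.

Lemma density_variance_moments : density_variance h = (m 2 - m 1 ^+ 2)%R.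
Proof.
have m1E : density_mean h = m 1 by apply: eq_Rintegral => x _; rewrite expr1.
rewrite /density_variance m1E.
have i k (a : R) : mu.-integrable setT (EFin \o (fun x => a * (x ^+ k * h x))).
  by have := integrableZl measurableT a (ih k).
transitivity (\int[mu]_x ((x ^+ 2 * h x) - (2 * m 1) * (x ^+ 1 * h x) + (m 1 ^+ 2) * (x ^+ 0 * h x))).
  by apply: eq_Rintegral => x _; ring.
rewrite RintegralD//; last first.
  exact: (integrableB measurableT (ih 2) (i 1%N (2 * m 1))).
rewrite RintegralB//; last exact: (ih 2).
rewrite (RintegralZl (2 * m 1) measurableT (ih 1)).
rewrite (RintegralZl (m 1 ^+ 2) measurableT (ih 0)).
have -> : \int[mu]_x (x ^+ 0 * h x) = 1.
  transitivity (\int[mu]_x h x); last by rewrite /Rintegral h1.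
  by apply: eq_Rintegral => x _; rewrite expr0 mul1r.
by rewrite -/(m 1) -/(m 2); ring.
Qed.

Lemma weak_cumulants_of_density :
  0 < weak_cumulant (regular_distribution f) phi 2 ->
  (density_mean h)%:C = weak_cumulant (regular_distribution f) phi 1 /\
  (density_variance h)%:C = weak_cumulant (regular_distribution f) phi 2.
Proof.
rewrite /weak_cumulant /weak_log_cf; case: xgetP => [K _ KE _|_]; last first.
  have -> : complex_deriven 2 (fun=> 0 : R[i]) 0 = 0.
    rewrite /complex_deriven/=.
    have d0 : complex_derive (fun=> 0 : R[i]) = (fun=> 0).
      by apply/funext => t; apply: complex_deriveE => /=; exact: is_derive_cst.
    by rewrite !d0.
  by rewrite mulr0 ltxx.
have [-> ->] := weak_cumulants KE.
have m1E : density_mean h = m 1 by apply: eq_Rintegral => x _; rewrite expr1.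
rewrite density_variance_moments m1E; split.
  have -> : 0 +i* m 1 = 'i * (m 1)%:C.
    by apply/eqP; rewrite eq_complex/=; apply/andP; split; apply/eqP; ring.
  by rewrite mulKf// eq_complex/= oner_eq0 andbF.
(* Dividing by i^2 = -1 turns [m 1 ^+ 2 - m 2] into the variance. *)
rewrite sqr_i invrN1 mulN1r.
by apply/eqP; rewrite eq_complex/= oppr0 opprB !eqxx.
Qed.

End WeakCumulantsOfDensity.

(** * Gaussian averages *)

(** The integral against [nu] is first written with the Radon-Nikodym derivative. [h] has the same
    integral as that derivative over every measurable set, so the two agree almost everywhere; this
    accommodates an [h] that is negative on a null set. *)
Lemma ge0_integral_density d (T : measurableType d) (R : realType)
    (mu : {sigma_finite_measure set T -> \bar R})
    (nu : {finite_measure set T -> \bar R}) (h : T -> R) (f : T -> \bar R) :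
  mu.-integrable setT (EFin \o h) ->
  (forall A, measurable A -> nu A = \int[mu]_(x in A) (h x)%:E)%E ->
  measurable_fun setT f -> (forall x, 0 <= f x)%E ->
  (\int[nu]_x f x = \int[mu]_x (f x * (h x)%:E))%E.
Proof.
move=> ih nuE mf f0.
have numu : nu `<< mu.
  apply/null_content_dominatesP => A mA muA0; rewrite nuE//.
  apply: null_set_integral => //.
  exact: measurable_funTS (measurable_int _ ih).
rewrite -(Radon_Nikodym_SigmaFinite.change_of_variables numu)//.
have iRN := Radon_Nikodym_SigmaFinite.f_integrable numu.
apply: ae_eq_integral => //.
- exact: emeasurable_funM mf (measurable_int _ iRN).
- exact: emeasurable_funM mf (measurable_int _ ih).
- apply: ae_eqe_mul2l; apply: integral_ae_eq => //.
    exact: measurable_int ih.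
  move=> E _ mE; rewrite -nuE//.
  exact/esym/Radon_Nikodym_SigmaFinite.f_integral.
Qed.

Section Gauss.
Context {R : realType}.
Local Notation mu := (@lebesgue_measure R).
Local Notation rT := (measurableTypeR R).

(** [a] times the image of Lebesgue measure under y -> b + a y gives each half-open interval its
    length, so it is Lebesgue measure by uniqueness. *)
Lemma ge0_integral_affine (a b : R) (f : R -> \bar R) : 0 < a ->
  measurable_fun [set: R] f -> (forall x, 0 <= f x)%E ->
  (\int[mu]_x f x = a%:E * \int[mu]_x f (b + a * x)%R)%E.
Proof.
move=> a0 mf f0.
pose F0 : rT -> rT := fun y => b + a * y.
have mF : measurable_fun setT F0.
  by apply: measurable_funD => //; apply: measurable_funM.
(* The canonical instance is named since unification cannot supply [mF]. *)
pose pF : {measure set rT -> \bar R} :=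
  measure_function_pushforward__canonical__measure_function_Measure mu mF.
pose m := mscale (NngNum (ltW a0)) pF.
have mE A : measurable A -> m A = mu A.
  move=> mA; apply/esym/lebesgue_measure_unique => //= _ [[u v]] _ <-.
  rewrite /m /mscale /= /pushforward.
  have -> : F0 @^-1` `]u, v] = `](u - b) / a, (v - b) / a]%classic.
    apply/seteqP; split => x /=; rewrite /F0 !in_itv/= ltr_pdivrMr// ler_pdivlMr//;
      by move=> /andP[] ? ?; apply/andP; split; lra.
  rewrite !lebesgue_measure_itv/= !lte_fin ltr_pM2r ?invr_gt0// ltrD2r.
  by case: ifPn => _; rewrite ?mule0// -!EFinD -EFinM; congr EFin; field; rewrite gt_eqF.
have -> : (\int[mu]_x f x = \int[m]_x f x)%E.
  by apply: eq_measure_integral => A mA _; exact/esym/mE.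
rewrite ge0_integral_mscale//= ge0_integral_pushforward//.
Qed.

Lemma ge0_integral_normal_prob (m s : R) (f : R -> \bar R) :
  measurable_fun [set: R] f -> (forall x, 0 <= f x)%E ->
  (\int[normal_prob m s]_x f x = \int[mu]_x (f x * (normal_pdf m s x)%:E))%E.
Proof.
by move=> mf f0; apply: ge0_integral_density => //; exact: integrable_normal_pdf.
Qed.

(** Brings shifted and scaled standard Gaussians to integrals against [normal_pdf m s], the form in
    which two kernels can be composed; the Jacobian [s] cancels against the peak of the density. *)
Lemma ge0_integral_normal_std (m s : R) (f : R -> \bar R) : 0 < s ->
  measurable_fun [set: R] f -> (forall x, 0 <= f x)%E ->
  (\int[normal_prob 0 1]_x f (m + s * x)%R = \int[normal_prob m s]_x f x)%E.
Proof.
move=> s0 mf f0; rewrite !ge0_integral_normal_prob//; last first.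
  apply: measurableT_comp => //.
  by apply: measurable_funD => //; apply: measurable_funM.
rewrite [RHS](@ge0_integral_affine s m)//; first last.
- by move=> x; rewrite mule_ge0// lee_fin normal_pdf_ge0.
- apply: emeasurable_funM => //; apply/measurable_EFinP.
  exact: measurable_normal_pdf.
have mf' : measurable_fun [set: R] (fun x => f (m + s * x)%R * (normal_pdf m s (m + s * x)%R)%:E)%E.
  apply: emeasurable_funM.
    apply: measurableT_comp => //.
    by apply: measurable_funD => //; apply: measurable_funM.
  apply/measurable_EFinP/measurableT_comp; first exact: measurable_normal_pdf.
  by apply: measurable_funD => //; apply: measurable_funM.
rewrite -ge0_integralZl//; first last.
- by rewrite lee_fin ltW.
- by move=> x _; rewrite mule_ge0// lee_fin normal_pdf_ge0.
apply: eq_integral => x _; rewrite muleCA; congr (_ * _)%E; rewrite -EFinM; congr EFin.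
rewrite !normal_pdfE ?oner_eq0 ?gt_eqF// mulrA; congr (_ * _).
  rewrite /normal_peak expr1n mul1r -mulrnAr sqrtrM ?sqr_ge0// sqrtr_sqr gtr0_norm// invfM mulrA divff ?mul1r// gt_eqF//.
rewrite /normal_fun; congr expR; field.
by rewrite gt_eqF.
Qed.
End Gauss.

Section GaussSemigroup.
Context {R : realType}.
Local Notation mu := (@lebesgue_measure R).
Local Notation rT := (measurableTypeR R).

Lemma normal_pdf_gt0E (m s x : R) : 0 < s ->
  normal_pdf m s x =
  (s * Num.sqrt (pi *+ 2))^-1 * expR (- ((x - m) ^+ 2 / (s ^+ 2 *+ 2))).
Proof.
move=> s0; rewrite normal_pdfE ?gt_eqF//; congr (_ * _).
  by rewrite /normal_peak -mulrnAr sqrtrM ?sqr_ge0// sqrtr_sqr gtr0_norm.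
by rewrite /normal_fun mulNr.
Qed.

(* Completing the square in [u]. *)
Lemma normal_pdfM (x s t u z : R) (r := Num.sqrt (s ^+ 2 + t ^+ 2)) :
  0 < s -> 0 < t ->
  normal_pdf u s z * normal_pdf x t u =
  normal_pdf x r z *
  normal_pdf ((x * s ^+ 2 + z * t ^+ 2) / r ^+ 2) (s * t / r) u.
Proof.
move=> s0 t0.
have r20 : 0 < s ^+ 2 + t ^+ 2 by rewrite addr_gt0// exprn_gt0.
have r0 : 0 < r by rewrite sqrtr_gt0.
have r2E : r ^+ 2 = s ^+ 2 + t ^+ 2 by rewrite sqr_sqrtr// ltW.
have p0 : 0 < Num.sqrt (pi *+ 2 : R) by rewrite sqrtr_gt0 mulrn_wgt0// pi_gt0.
rewrite !normal_pdf_gt0E ?divr_gt0 ?mulr_gt0//.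
rewrite mulrACA [RHS]mulrACA -!expRD; congr (_ * expR _).
  by field; rewrite !gt_eqF.
rewrite [in RHS]expr_div_n [(s * t) ^+ 2]exprMn r2E !mulr2n; field.
by rewrite !gt_eqF ?addr_gt0 ?exprn_gt0 ?mulr_gt0.
Qed.

Lemma measurable_normal_pdf2 (s : R) : 0 < s ->
  measurable_fun setT (fun z : rT * rT => normal_pdf z.1 s z.2).
Proof.
move=> s0; under eq_fun do rewrite normal_pdf_gt0E//.
apply: measurable_funM => //; apply: measurableT_comp => //.
apply: measurableT_comp => //; apply: measurable_funM => //.
apply: measurable_funX; apply: measurable_funB; first exact: measurable_snd.
exact: measurable_fst.
Qed.

(** The sum of two independent Gaussians, seen as a composition of kernels. After Tonelli,
    [normal_pdfM] splits off a factor that is a probability density in the intermediate point [u]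
    and integrates to 1. *)
Lemma ge0_integral_normal_semigroup (x s t : R) (f : R -> \bar R) :
  0 < s -> 0 < t -> measurable_fun [set: R] f -> (forall x, 0 <= f x)%E ->
  (\int[normal_prob 0 1]_y \int[normal_prob 0 1]_z f (x + t * y + s * z)%R =
   \int[normal_prob 0 1]_w f (x + Num.sqrt (s ^+ 2 + t ^+ 2) * w)%R)%E.
Proof.
move=> s0 t0 mf f0; set r := Num.sqrt _.
have r20 : 0 < s ^+ 2 + t ^+ 2 by rewrite addr_gt0// exprn_gt0.
have r0 : 0 < r by rewrite sqrtr_gt0.
have q0 : 0 < s * t / r by rewrite divr_gt0// mulr_gt0.
pose k (z : rT * rT) : \bar R := (f z.2 * (normal_pdf z.1 s z.2)%:E)%E.
have k0 z : (0 <= k z)%E by rewrite mule_ge0// lee_fin normal_pdf_ge0.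
have mk : measurable_fun setT k.
  apply: emeasurable_funM; last by apply/measurable_EFinP; exact: measurable_normal_pdf2.
  by apply: measurableT_comp => //; exact: measurable_snd.
pose K u := (\int[mu]_z k (u, z))%E.
have K0 u : (0 <= K u)%E by exact: integral_ge0.
have mK : measurable_fun [set: rT] K by exact: measurable_fun_fubini_tonelli_F.
transitivity (\int[normal_prob (0 : R) 1]_y K (x + t * y)%R)%E.
  apply: eq_integral => y _.
  by rewrite ge0_integral_normal_std// ge0_integral_normal_prob.
rewrite (@ge0_integral_normal_std _ x t K t0 mK K0).
rewrite (@ge0_integral_normal_prob _ x t K mK K0).
pose l (z : rT * rT) : \bar R := (k z * (normal_pdf x t z.1)%:E)%E.
have l0 z : (0 <= l z)%E by rewrite mule_ge0// lee_fin normal_pdf_ge0.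
have ml : measurable_fun setT l.
  apply: emeasurable_funM => //; apply/measurable_EFinP.
  apply: measurableT_comp; first exact: measurable_normal_pdf.
  exact: measurable_fst.
transitivity (\int[mu]_u \int[mu]_z l (u, z))%E.
  apply: eq_integral => u _; rewrite /l/= ge0_integralZr//.
  - by apply: measurableT_comp => //; exact: pair1_measurable.
  - by rewrite lee_fin normal_pdf_ge0.
rewrite (fubini_tonelli (m1 := mu) (m2 := mu))//.
rewrite (@ge0_integral_normal_std _ x r f r0 mf f0).
rewrite (@ge0_integral_normal_prob _ x r f mf f0).
apply: eq_integral => z _.
pose m := (x * s ^+ 2 + z * t ^+ 2) / r ^+ 2.
transitivity (\int[mu]_u ((f z * (normal_pdf x r z)%:E) * (normal_pdf m (s * t / r) u)%:E))%E.
  apply: eq_integral => u _; rewrite /l /k/= -!muleA; congr (_ * _)%E.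
  by rewrite -!EFinM normal_pdfM.
rewrite ge0_integralZl//.
- by rewrite integral_normal_pdf mule1.
- by apply/measurable_EFinP; exact: measurable_normal_pdf.
- by move=> u _; rewrite lee_fin normal_pdf_ge0.
- by rewrite mule_ge0// lee_fin normal_pdf_ge0.
Qed.
End GaussSemigroup.

(** * Moments of the standard Gaussian *)

Section GaussMoments.
Context {R : realType}.
Local Notation N01 := (normal_prob (0 : R) 1).

(* [normal_pdf 0 1 y * e^(ty - t^2/2) = normal_pdf t 1 y] *)
Lemma integral_normal_expR (t : R) :
  (\int[N01]_y (expR (t * y))%:E = (expR (t ^+ 2 / 2))%:E)%E.
Proof.
rewrite ge0_integral_normal_prob; first last.
- by move=> x; rewrite lee_fin expR_ge0.
- apply/measurable_EFinP; apply: measurableT_comp => //; exact: measurable_funM.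
transitivity (\int[lebesgue_measure]_y ((expR (t ^+ 2 / 2))%:E * (normal_pdf t 1 y)%:E))%E.
  apply: eq_integral => y _; rewrite -!EFinM; congr EFin.
  rewrite !normal_pdf_gt0E// [LHS]mulrCA [RHS]mulrCA -!expRD; congr (_ * expR _).
  by field.
rewrite ge0_integralZl//.
- by rewrite integral_normal_pdf mule1.
- by apply/measurable_EFinP; exact: measurable_normal_pdf.
- by move=> x _; rewrite lee_fin normal_pdf_ge0.
Qed.

Lemma integrable_normal_expR (t : R) : N01.-integrable setT (fun y => (expR (t * y))%:E).
Proof.
apply/integrableP; split.
  by apply/measurable_EFinP; apply: measurableT_comp => //; exact: measurable_funM.
under eq_integral do rewrite gee0_abs ?lee_fin ?expR_ge0//.
by rewrite integral_normal_expR ltry.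
Qed.

Lemma exprn_le_expR (x : R) n : 0 <= x -> x ^+ n / n`!%:R <= expR x.
Proof.
case: n => [|n] x0; first by rewrite expr0 divr1 -expR0 ler_expR.
by apply: le_trans (expR_ge1Dxn n x0); rewrite lerDr.
Qed.

(** From |y|^k <= k! e^|y| and e^|y| <= e^y + e^(-y): the exponents [t + 1] and [t - 1] absorb the
    power. *)
Lemma integrable_normal_moment (k : nat) (t : R) :
  N01.-integrable setT (fun y => (`|y| ^+ k * expR (t * y))%:E).
Proof.
have i := integrableD measurableT (integrable_normal_expR (t + 1)) (integrable_normal_expR (t - 1)).
have {}i := integrableZl measurableT (k`!%:R) i.
apply: le_integrable i => //.
  apply/measurable_EFinP; apply: measurable_funM => //.
    by apply: measurable_funX; exact: normr_measurable.
  by apply: measurableT_comp => //; exact: measurable_funM.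
move=> y _; rewrite /= lee_fin.
rewrite [leLHS]ger0_norm ?mulr_ge0 ?exprn_ge0 ?expR_ge0//.
rewrite [leRHS]ger0_norm ?mulr_ge0 ?addr_ge0 ?expR_ge0//.
apply: (@le_trans _ _ (k`!%:R * expR `|y| * expR (t * y))).
  rewrite ler_wpM2r ?expR_ge0// -ler_pdivrMl ?ltr0n ?fact_gt0// mulrC.
  exact: exprn_le_expR.
rewrite -mulrA -expRD ler_wpM2l// mulrDl mulrBl mul1r.
case: (leP 0 y) => y0.
  rewrite ger0_norm// [y + _]addrC lerDl expR_ge0//.
rewrite ltr0_norm// [- y + _]addrC lerDr expR_ge0//.
Qed.

Lemma normal_mgf_derive (k : nat) (t : R) :
  is_derive t 1 (fun t => \int[N01]_y (y ^+ k * expR (t * y)))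
    (\int[N01]_y (y ^+ k.+1 * expR (t * y))).
Proof.
(* No single function dominates for all parameters; on []t - 1, t + 1[] the exponential is at most
   the sum of those at the two endpoints. *)
apply: (@is_derive_Rintegral _ _ R N01 (fun t y => y ^+ k * expR (t * y))
  (fun t y => y ^+ k.+1 * expR (t * y))
  (fun y => `|y| ^+ k.+1 * expR ((t + 1) * y) + `|y| ^+ k.+1 * expR ((t - 1) * y)) (t - 1) (t + 1)).
- by rewrite ltrBlDr ltrDl ltr01.
- move=> x _.
  apply: le_integrable (integrable_normal_moment k x) => //.
    apply/measurable_EFinP; apply: measurable_funM => //.
    by apply: measurableT_comp => //; exact: measurable_funM.
  by move=> y _; rewrite /= lee_fin !normrM !normrX normr_id.
- move=> s y _.
  have dm : is_derive s 1 (fun u : R => u * y) y by apply: is_derive_eq; rewrite /GRing.scale/=; ring.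
  have dc := @is_derive1_comp R expR (fun u => u * y) s _ _ (is_derive_expR (s * y)) dm.
  have -> : (fun u => y ^+ k * expR (u * y)) = y ^+ k \*: (expR \o (fun u => u * y)) by [].
  by apply: is_derive_eq; rewrite /GRing.scale/= exprS; ring.
- exact: (integrableD measurableT (integrable_normal_moment k.+1 (t + 1))
            (integrable_normal_moment k.+1 (t - 1))).
- move=> s y /andP[s1 s2]; rewrite normrM normrX (ger0_norm (expR_ge0 _)).
  rewrite -mulrDr ler_wpM2l//.
  case: (leP 0 y) => y0.
    by rewrite ler_wpDr ?expR_ge0// ler_expR ler_wpM2r// ltW.
  by rewrite ler_wpDl ?expR_ge0// ler_expR ler_wnM2r// ltW.
Qed.

(** The moments are derivatives at 0 of the moment generating function e^(t^2/2). [M 1] is found for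
    every [t] because it is differentiated once more. *)
Lemma normal_moment12 :
  \int[N01]_y y = 0 /\ \int[N01]_y (y ^+ 2) = 1.
Proof.
pose M k t := \int[N01]_y (y ^+ k * expR (t * y)).
have M0 : M 0%N = fun t => expR (t ^+ 2 / 2).
  apply/funext => t; rewrite /M /Rintegral.
  by under eq_integral do rewrite expr0 mul1r; rewrite integral_normal_expR.
have d0 (t : R) : is_derive t 1 (fun t : R => expR (t ^+ 2 / 2)) (t * expR (t ^+ 2 / 2)).
  have dm : is_derive t 1 (fun u : R => u ^+ 2 / 2) t.
    have -> : (fun u : R => u ^+ 2 / 2) = (fun u : R => u * u) * cst 2^-1.
      by apply/funext => u; rewrite expr2.
    apply: is_derive_eq; rewrite /GRing.scale/=; by field.
  have dc := @is_derive1_comp R expR (fun u : R => u ^+ 2 / 2) t _ _ (is_derive_expR _) dm.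
  by apply: is_derive_eq; rewrite mulrC.
have M1 : M 1%N = fun t => t * expR (t ^+ 2 / 2).
  apply/funext => t; have := normal_mgf_derive 0 t; rewrite -/(M 0%N) M0 => -[_ H]; rewrite /M -H.
  by have [_ ->] := d0 t.
have M2 : M 2%N 0 = 1.
  have := normal_mgf_derive 1 0; rewrite -/(M 1%N) M1 => -[_ H]; rewrite /M -H.
  have d1 : is_derive (0 : R) 1 (fun t : R => t * expR (t ^+ 2 / 2)) 1.
    by apply: is_derive_eq; rewrite /GRing.scale/= expr0n/= !mul0r expR0; ring.
  by have [_ ->] := d1.
split.
  have M10 : M 1%N 0 = 0 by rewrite M1 mul0r.
  by rewrite -[RHS]M10; apply: eq_Rintegral => y _; rewrite mul0r expR0 mulr1 expr1.
by rewrite -[RHS]M2; apply: eq_Rintegral => y _; rewrite mul0r expR0 mulr1.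
Qed.

End GaussMoments.

(** * Sums of independent random variables *)

Section IndependentSums.
Context {R : realType} {d : measure_display} {T : measurableType d}.
Variable P : probability T R.
Variable X : nat -> {RV P >-> R}.

Lemma measurable_partial_sum n : measurable_fun setT (fun w => \sum_(i < n) X i w).
Proof.
elim: n => [|n ih]; first by under eq_fun do rewrite big_ord0; exact: measurable_cst.
by under eq_fun do rewrite big_ord_recr/=; exact: measurable_funD.
Qed.

Definition partial_sum n : {RV P >-> R} :=
  HB.pack (fun w => \sum_(i < n) X i w)
    (isMeasurableFun.Build _ _ _ _ _ (measurable_partial_sum n)).

Hypothesis indepX : mutually_independent X.

Let ev (J : {fset nat}) (A : nat -> set R) := \bigcap_(i in [set` J]) (X i @^-1` A i).

Let measurable_ev J A : (forall i, measurable (A i)) -> measurable (ev J A).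
Proof.
move=> mA; apply: fin_bigcap_measurable => [|i _]; first exact: finite_fset.
exact: measurable_funPTI.
Qed.

Lemma measurable_partial_sum_pair n :
  measurable_fun setT (fun w => (partial_sum n w, X n w)).
Proof. exact: measurable_fun_pair. Qed.

Definition partial_sum_pair n : {mfun T >-> (R * R)%type} :=
  HB.pack (fun w => (partial_sum n w, X n w))
    (isMeasurableFun.Build _ _ _ _ _ (measurable_partial_sum_pair n)).

(* The inductive hypothesis on [n] must involve events on finitely many later
   variables, not only on the next one. *)
Let indep_upto n := forall (J : {fset nat}) (A : nat -> set R) (B : set R),
  (forall i, i \in J -> (n <= i)%N) -> (forall i, measurable (A i)) -> measurable B ->
  (P (partial_sum n @^-1` B `&` ev J A) =
   P (partial_sum n @^-1` B) * P (ev J A))%E.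

(** Conditioned on [ev J A], the pair has on rectangles the product of the unconditional laws;
    uniqueness of the product measure extends this to all [C]. *)
Let indep_pair n : indep_upto n ->
  forall (J : {fset nat}) (A : nat -> set R) (C : set (R * R)),
  (forall i, i \in J -> (n < i)%N) -> (forall i, measurable (A i)) -> measurable C ->
  (P (partial_sum_pair n @^-1` C `&` ev J A) =
   (distribution P (partial_sum n) \x distribution P (X n)) C * P (ev J A))%E.
Proof.
move=> ih J A C Jn mA mC.
have mE := measurable_ev J mA.
(* A null event cannot be conditioned on; both sides then vanish. *)
have [E0|E0] := eqVneq (P (ev J A)) 0%E.
  rewrite E0 mule0; apply/eqP; rewrite -measure_le0 -E0 le_measure ?inE//.
  by apply: measurableI => //; exact: measurable_funPTI.
pose p := fine (P (ev J A)).
have pE : P (ev J A) = p%:E by rewrite fineK// fin_num_measure.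
have p0 : 0 < p by rewrite lt_neqAle fine_ge0// andbT eq_sym -eqe -pE.
have ip0 : 0 <= p^-1 by rewrite invr_ge0 ltW.
(* [m] is the law of the pair restricted to [ev J A] and divided by the probability of that
   event. *)
pose m0 : {measure set (R * R) -> \bar R} :=
  measure_function_pushforward__canonical__measure_function_Measure
    (mrestr P mE) (measurable_partial_sum_pair n).
pose m := mscale (NngNum ip0) m0.
have mC' : (distribution P (partial_sum n) \x distribution P (X n))%E C = m C.
  apply: product_measure_unique => // B1 B2 mB1 mB2.
  (* The condition on [X n] joins the later events, so that the hypothesis on [n] applies with [n]
     added to the index set. *)
  pose A' i := if i == n then B2 else A i.
  have evA' : ev (n |` J)%fset A' = X n @^-1` B2 `&` ev J A.
    apply/seteqP; split => w.
      move=> h; split; first by have := h n; rewrite /A' eqxx; apply => /=; rewrite in_fset1U eqxx.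
      move=> i /= iJ; have := h i; rewrite /A' /= in_fset1U iJ orbT.
      by rewrite gtn_eqF ?Jn//; apply.
    move=> [h1 h2] i /=; rewrite in_fset1U /A'; case: eqP => [-> _//|_ /=]; exact: h2.
  have mA' i : measurable (A' i) by rewrite /A'; case: ifP.
  transitivity
      (p^-1%:E * P (partial_sum n @^-1` B1 `&` ev (n |` J)%fset A'))%E.
    by rewrite evA' setIA.
  rewrite ih//; last first.
    by move=> i; rewrite in_fset1U => /orP[/eqP ->//|/Jn/ltnW].
  rewrite muleCA [RHS](_ : _ = P (partial_sum n @^-1` B1) * P (X n @^-1` B2))%E//.
  congr (_ * _)%E; rewrite /ev indepX// big_fsetU1/=; last first.
    by apply/negP => /Jn; rewrite ltnn.
  rewrite /A' eqxx [X in (_ * (_ * X))%E](_ : _ = P (ev J A)).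
    rewrite pE muleCA -EFinM mulVf ?mule1// gt_eqF//.
  rewrite /ev indepX// !big_seq; apply: eq_bigr => i iJ.
  by rewrite gtn_eqF ?Jn.
rewrite mC' /m /mscale /pushforward/= /mrestr pE muleAC -EFinM mulVf ?mul1e// gt_eqF//.
Qed.

(** An event of the next sum is an event of the pair formed by the current sum and the next
    variable, so [indep_pair] carries the induction. *)
Let indep_uptoP n : indep_upto n.
Proof.
elim: n => [|n ih] J A B Jn mA mB.
  have S0 : partial_sum 0 = cst 0 :> (T -> R) by apply/funext => w /=; rewrite big_ord0.
  rewrite S0 preimage_cst; case: ifP => _.
    by rewrite setTI probability_setT mul1e.
  by rewrite set0I measure0 mul0e.
pose C := (fun z : R * R => z.1 + z.2) @^-1` B.
have mC : measurable C.
  rewrite -[C]setTI; have : measurable_fun setT (fun z : R * R => z.1 + z.2).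
    exact: measurable_funD.
  exact.
have SE : partial_sum n.+1 @^-1` B = partial_sum_pair n @^-1` C.
  by apply/seteqP; split => w; rewrite /preimage/= big_ord_recr.
rewrite SE (indep_pair ih)//; congr (_ * _)%E.
(* For the empty index set the event is the whole space, which yields the law of the pair alone. *)
have := @indep_pair n ih fset0 A C.
have -> : ev fset0 A = setT by apply/seteqP; split => // w _ i /=.
by rewrite setIT probability_setT mule1 => ->.
Qed.

(** Independence enters the replacement only through this identity: the pair has the product law,
    and Tonelli makes [w'] range over an independent copy. *)
Lemma ge0_integral_partial_sumS n (g : R -> \bar R) :
  measurable_fun setT g -> (forall x, 0 <= g x)%E ->
  (\int[P]_w g (partial_sum n.+1 w) =
   \int[P]_w \int[P]_w' g (partial_sum n w + X n w')%R)%E.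
Proof.
move=> mg g0.
have mG : measurable_fun setT (fun z : R * R => g (z.1 + z.2)).
  by apply: measurableT_comp => //; exact: measurable_funD.
have mG1 x : measurable_fun [set: R] (fun y => g (x + y)).
  by apply: measurableT_comp => //; exact: measurable_funD.
transitivity (\int[distribution P (partial_sum_pair n)]_z g (z.1 + z.2)%R)%E.
  rewrite ge0_integral_distribution//; apply: eq_integral => w _ /=.
  by rewrite big_ord_recr.
transitivity (\int[distribution P (partial_sum n) \x distribution P (X n)]_z g (z.1 + z.2)%R)%E.
  apply: eq_measure_integral => C mC _.
  have := @indep_pair n (@indep_uptoP n) fset0 (fun=> setT) C.
  have -> : ev fset0 (fun=> setT) = setT by apply/seteqP; split => // w _ i /=.
  rewrite setIT probability_setT mule1; exact.
rewrite fubini_tonelli1// ge0_integral_distribution//.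
- apply: eq_integral => w _.
  rewrite /fubini_F/= ge0_integral_distribution//.
- exact: measurable_fun_fubini_tonelli_F.
- by move=> x; rewrite integral_ge0.
Qed.

End IndependentSums.

(** * Lindeberg's replacement method *)

Section BoundedIntegrals.
Context d (T : measurableType d) (R : realType) (P : probability T R).

Lemma integrable_le_cst (u : T -> R) (M : R) :
  measurable_fun setT u -> (forall w, `|u w| <= M) -> P.-integrable setT (EFin \o u).
Proof.
move=> mu uM; apply: le_integrable (finite_measure_integrable_cst P M measurableT) => //.
  exact/measurable_EFinP.
by move=> w _; rewrite /= lee_fin (le_trans (uM w))// ler_norm.
Qed.

Lemma integrable_itv01 (u : T -> R) :
  measurable_fun setT u -> (forall w, 0 <= u w <= 1) -> P.-integrable setT (EFin \o u).
Proof.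
move=> mu u01; apply: (@integrable_le_cst _ 1) => // w.
by have /andP[u0 u1] := u01 w; rewrite ger0_norm.
Qed.

Lemma EFin_Rintegral_itv01 (u : T -> R) :
  measurable_fun setT u -> (forall w, 0 <= u w <= 1) ->
  ((\int[P]_w u w)%:E = \int[P]_w (u w)%:E)%E.
Proof.
move=> mu u01; rewrite /Rintegral fineK//.
exact/(integrable_fin_num measurableT)/integrable_itv01.
Qed.

Lemma Rintegral_prob_cst (a : R) : \int[P]_w a = a.
Proof. by rewrite Rintegral_cst//= probability_setT mulr1. Qed.

Lemma Rintegral_itv01 (u : T -> R) :
  measurable_fun setT u -> (forall w, 0 <= u w <= 1) -> 0 <= \int[P]_w u w <= 1.
Proof.
move=> mu u01; rewrite Rintegral_ge0/=; last by move=> w _; have /andP[] := u01 w.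
rewrite -[leRHS]Rintegral_prob_cst; apply: le_Rintegral => //.
- exact: integrable_itv01.
- exact: finite_measure_integrable_cst.
- by move=> w _; have /andP[] := u01 w.
Qed.

(** The linear term integrates to 0 and the quadratic one sees [X] only through its second moment,
    so two variables agreeing there have nearly equal integrals. *)
Lemma Rintegral_taylor (X : T -> R) (a b c K B : R) (u : T -> R) :
  measurable_fun setT X -> measurable_fun setT u -> (forall w, 0 <= u w <= 1) ->
  P.-integrable setT (fun w => (`|X w| ^+ 3)%:E) ->
  \int[P]_w X w = 0 -> \int[P]_w (`|X w| ^+ 3) <= B -> 0 <= K ->
  (forall w, `|u w - a - b * X w - c * X w ^+ 2| <= K * `|X w| ^+ 3) ->
  `|\int[P]_w u w - a - c * \int[P]_w (X w ^+ 2)| <= K * B.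
Proof.
move=> mX mu u01 iX3 X0 X3B K0 uX.
have i1 (r : R) : P.-integrable setT (EFin \o cst r) by exact: finite_measure_integrable_cst.
(* 1 + |X|^3 dominates both |X| and X^2, so the third moment gives the integrability of the lower
   powers. *)
have i3 : P.-integrable setT (EFin \o (fun w => 1 + `|X w| ^+ 3)).
  exact: (integrableD measurableT (i1 1) iX3).
have iX : P.-integrable setT (EFin \o X).
  apply: le_integrable i3 => //; first exact/measurable_EFinP.
  move=> w _; rewrite /= lee_fin [leRHS]ger0_norm ?addr_ge0//.
  have := normr_ge0 (X w); move: `|X w| => y y0.
  have [y1|/ltW y1] := leP y 1; first by rewrite ler_wpDr// exprn_ge0.
  rewrite ler_wpDl// exprS ler_peMr//; nra.
have iX2 : P.-integrable setT (EFin \o (fun w => X w ^+ 2)).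
  apply: le_integrable i3 => //.
    by apply/measurable_EFinP; exact: measurable_funX.
  move=> w _; rewrite /= lee_fin [leRHS]ger0_norm ?addr_ge0// normrX.
  have := normr_ge0 (X w); move: `|X w| => y y0.
  have [y1|/ltW y1] := leP y 1; first by rewrite ler_wpDr// ?exprn_ge0// expr_le1.
  rewrite ler_wpDl// [leRHS]exprS ler_peMl// ?exprn_ge0//.
have iu := integrable_itv01 mu u01.
have ibX : P.-integrable setT (EFin \o (fun w => b * X w)).
  exact: (integrableZl measurableT b iX).
have icX : P.-integrable setT (EFin \o (fun w => c * X w ^+ 2)).
  exact: (integrableZl measurableT c iX2).
have iua : P.-integrable setT (EFin \o (fun w => u w - a)).
  exact: (integrableB measurableT iu (i1 a)).
have iuab : P.-integrable setT (EFin \o (fun w => u w - a - b * X w)).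
  exact: (integrableB measurableT iua ibX).
have iuabc : P.-integrable setT (EFin \o (fun w => u w - a - b * X w - c * X w ^+ 2)).
  exact: (integrableB measurableT iuab icX).
have -> : \int[P]_w u w - a - c * \int[P]_w (X w ^+ 2) =
    \int[P]_w (u w - a - b * X w - c * X w ^+ 2).
  rewrite (RintegralB measurableT iuab icX) (RintegralB measurableT iua ibX).
  rewrite (RintegralB measurableT iu (i1 a)) (RintegralZl b measurableT iX).
  by rewrite (RintegralZl c measurableT iX2) X0 mulr0 subr0 Rintegral_prob_cst.
apply: (le_trans (le_normr_Rintegral measurableT iuabc)).
apply: (@le_trans _ _ (\int[P]_w (K * `|X w| ^+ 3))).
  apply: le_Rintegral => //; first exact: (integrable_norm iuabc).
  exact: (integrableZl measurableT K iX3).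
by rewrite (RintegralZl K measurableT iX3) ler_wpM2l.
Qed.

End BoundedIntegrals.

(* [g1] and [g2] stand for g' and g''/2. *)
Definition taylor2 {R : realType} (K : R) (g g1 g2 : R -> R) :=
  forall x y, `|g (x + y) - g x - g1 x * y - g2 x * y ^+ 2| <= K * `|y| ^+ 3.

Section Lindeberg.
Context {R : realType}.
Local Notation rT := (measurableTypeR R).
Local Notation N01 := (normal_prob (0 : R) 1).

Definition gauss_avg (s : R) (g : R -> R) (x : R) := \int[N01]_y g (x + s * y).

Lemma measurable_affine (a b : R) : measurable_fun [set: R] (fun y => b + a * y : R).
Proof. by apply: measurable_funD => //; exact: measurable_funM. Qed.

Lemma gauss_avg0 (g : R -> R) : gauss_avg 0 g = g.
Proof.
apply/funext => x; rewrite -[RHS](Rintegral_prob_cst N01); apply: eq_Rintegral => y _.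
by rewrite mul0r addr0.
Qed.

Lemma gauss_avg_itv01 s (g : R -> R) : measurable_fun [set: R] g ->
  (forall x, 0 <= g x <= 1) -> forall x, 0 <= gauss_avg s g x <= 1.
Proof.
move=> mg g01 x; apply: Rintegral_itv01 => //.
by apply: measurableT_comp => //; exact: measurable_affine.
Qed.

Lemma measurable_gauss_avg s (g : R -> R) : measurable_fun [set: R] g ->
  (forall x, 0 <= g x <= 1) -> measurable_fun [set: R] (gauss_avg s g).
Proof.
move=> mg g01; apply/measurable_EFinP.
rewrite (_ : _ \o _ = fubini_F (N01 : probability rT R) (fun z : rT * rT => (g (z.1 + s * z.2))%:E)).
  apply: measurable_fun_fubini_tonelli_F => [|z]; last by rewrite lee_fin; have /andP[] := g01 (z.1 + s * z.2).
  apply/measurable_EFinP; apply: measurableT_comp => //.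
  apply: measurable_funD; first exact: measurable_fst.
  apply: measurable_funM => //; exact: measurable_snd.
apply/funext => x; rewrite /= /gauss_avg EFin_Rintegral_itv01//.
by apply: measurableT_comp => //; exact: measurable_affine.
Qed.

Lemma gauss_avg_semigroup s t (g : R -> R) x : 0 <= s -> 0 < t ->
  measurable_fun [set: R] g -> (forall x, 0 <= g x <= 1) ->
  gauss_avg t (gauss_avg s g) x = gauss_avg (Num.sqrt (s ^+ 2 + t ^+ 2)) g x.
Proof.
(* The case [s = 0] escapes the density computation; it occurs in [lindeberg_step] when no Gaussian
   has yet been put in. *)
move=> s0 t0 mg g01; have [->|sn0] := eqVneq s 0.
  by rewrite gauss_avg0 expr0n/= add0r sqrtr_sqr gtr0_norm.
have {sn0}s0 : 0 < s by rewrite lt_neqAle eq_sym sn0.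
rewrite /gauss_avg /Rintegral; congr fine.
rewrite -(@ge0_integral_normal_semigroup R x s t (fun y => (g y)%:E))//; first last.
- by move=> y; rewrite lee_fin; have /andP[] := g01 y.
- exact/measurable_EFinP.
apply: eq_integral => y _; rewrite EFin_Rintegral_itv01//.
by apply: measurableT_comp => //; exact: measurable_affine.
Qed.

(** The Taylor inequality is simply integrated, which leaves the constant [K] unchanged; [M]
    provides the integrability of [g1] and [g2]. *)
Lemma taylor2_gauss_avg (K s M : R) (g g1 g2 : R -> R) :
  [/\ measurable_fun [set: R] g, measurable_fun [set: R] g1 & measurable_fun [set: R] g2] ->
  (forall x, 0 <= g x <= 1) -> (forall x, `|g1 x| <= M) -> (forall x, `|g2 x| <= M) ->
  taylor2 K g g1 g2 -> taylor2 K (gauss_avg s g) (gauss_avg s g1) (gauss_avg s g2).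
Proof.
move=> [mg mg1 mg2] g01 g1M g2M gT x y.
have i0 z : N01.-integrable setT (EFin \o (fun w => g (z + s * w))).
  apply: integrable_itv01 => //.
  by apply: measurableT_comp => //; exact: measurable_affine.
have i1 : N01.-integrable setT (EFin \o (fun w => g1 (x + s * w))).
  apply: (@integrable_le_cst _ _ _ _ _ M) => //.
  by apply: measurableT_comp => //; exact: measurable_affine.
have i2 : N01.-integrable setT (EFin \o (fun w => g2 (x + s * w))).
  apply: (@integrable_le_cst _ _ _ _ _ M) => //.
  by apply: measurableT_comp => //; exact: measurable_affine.
have i1y : N01.-integrable setT (EFin \o (fun w => g1 (x + s * w) * y)).
  exact: (integrableZr measurableT y i1).
have i2y : N01.-integrable setT (EFin \o (fun w => g2 (x + s * w) * y ^+ 2)).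
  exact: (integrableZr measurableT (y ^+ 2) i2).
have j1 : N01.-integrable setT (EFin \o (fun w => g (x + y + s * w) - g (x + s * w))).
  exact: (integrableB measurableT (i0 _) (i0 _)).
have j2 : N01.-integrable setT (EFin \o (fun w => g (x + y + s * w) - g (x + s * w) - g1 (x + s * w) * y)).
  exact: (integrableB measurableT j1 i1y).
have j3 : N01.-integrable setT (EFin \o (fun w => g (x + y + s * w) - g (x + s * w)
    - g1 (x + s * w) * y - g2 (x + s * w) * y ^+ 2)).
  exact: (integrableB measurableT j2 i2y).
rewrite /gauss_avg -(RintegralZr y measurableT i1) -(RintegralZr (y ^+ 2) measurableT i2).
rewrite -(RintegralB measurableT (i0 _) (i0 _)) -(RintegralB measurableT j1 i1y).
rewrite -(RintegralB measurableT j2 i2y).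
apply: (le_trans (le_normr_Rintegral measurableT j3)).
rewrite -[leRHS](Rintegral_prob_cst N01); apply: le_Rintegral => //.
- exact: (integrable_norm j3).
- exact: finite_measure_integrable_cst.
- by move=> w _; rewrite (addrAC x y); exact: gT.
Qed.

Section IndependentSum.
Context {d : measure_display} {T : measurableType d}.
Variables (P : probability T R) (X : nat -> {RV P >-> R}).
Hypothesis indepX : mutually_independent X.

Lemma Rintegral_partial_sumS n (u : R -> R) :
  measurable_fun [set: R] u -> (forall x, 0 <= u x <= 1) ->
  measurable_fun [set: R] (fun x => \int[P]_w u (x + X n w)) /\
  \int[P]_w u (partial_sum X n.+1 w) =
  \int[P]_w \int[P]_w' u (partial_sum X n w + X n w').
Proof.
move=> mu u01.
have mux x : measurable_fun setT (fun w => u (x + X n w)).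
  by apply: measurableT_comp => //; exact: measurable_funD.
split.
  apply/measurable_EFinP.
  rewrite (_ : _ \o _ = fubini_F (P : probability T R) (fun z : R * T => (u (z.1 + X n z.2))%:E)).
    apply: measurable_fun_fubini_tonelli_F => [|z]; last by rewrite lee_fin; have /andP[] := u01 (z.1 + X n z.2).
    apply/measurable_EFinP; apply: measurableT_comp => //.
    apply: measurable_funD; first exact: measurable_fst.
    by apply: measurableT_comp => //; exact: measurable_snd.
  by apply/funext => x; rewrite /= EFin_Rintegral_itv01.
rewrite /Rintegral; congr fine.
rewrite (@ge0_integral_partial_sumS _ _ _ _ _ indepX n (fun x => (u x)%:E)).
- by apply: eq_integral => w _; rewrite EFin_Rintegral_itv01.
- exact/measurable_EFinP.
- by move=> x; rewrite lee_fin; have /andP[] := u01 x.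
Qed.

Variables (K M v B : R) (g g1 g2 : R -> R).
Hypothesis mg : [/\ measurable_fun [set: R] g, measurable_fun [set: R] g1 & measurable_fun [set: R] g2].
Hypothesis g01 : forall x, 0 <= g x <= 1.
Hypothesis g1M : forall x, `|g1 x| <= M.
Hypothesis g2M : forall x, `|g2 x| <= M.
Hypothesis K0 : 0 <= K.
Hypothesis gT : taylor2 K g g1 g2.
Hypothesis v0 : 0 < v.
Hypothesis iX : forall n, P.-integrable setT (fun w => (`|X n w| ^+ 3)%:E).
Hypothesis X1 : forall n, \int[P]_w X n w = 0.
Hypothesis X2 : forall n, \int[P]_w (X n w ^+ 2) = v ^+ 2.
Hypothesis X3 : forall n, \int[P]_w (`|X n w| ^+ 3) <= B.

Let beta := \int[N01]_y (`|y| ^+ 3).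

Let integrable_N3 : N01.-integrable setT (fun y => (`|y| ^+ 3)%:E).
Proof.
have := @integrable_normal_moment R 3 0; congr (_.-integrable _ _); apply/funext => y.
by rewrite mul0r expR0 mulr1.
Qed.

(** Both averages are close to the same value [u x + u2 x * v ^+ 2], where [u] and [u2] are the
    averages of [g] and [g2]: the first moments vanish and both second moments are [v ^+ 2]. *)
Lemma replace_by_gauss n s x :
  `|\int[P]_w gauss_avg s g (x + X n w) - gauss_avg v (gauss_avg s g) x| <=
  K * (B + v ^+ 3 * beta).
Proof.
have [mg0 mg1 mg2] := mg.
have uT := taylor2_gauss_avg s mg g01 g1M g2M gT.
have mu := measurable_gauss_avg s mg0 g01.
have u01 := gauss_avg_itv01 s mg0 g01.
set u := gauss_avg s g in uT mu u01 *.
set u1 := gauss_avg s g1 in uT; set u2 := gauss_avg s g2 in uT.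
have muX : measurable_fun setT (fun w => u (x + X n w)).
  by apply: measurableT_comp => //; exact: measurable_funD.
have mXn : measurable_fun setT (X n) by [].
have hX := @Rintegral_taylor _ _ _ P (X n) (u x) (u1 x) (u2 x) K B (fun w => u (x + X n w))
  mXn muX (fun w => u01 _) (iX n) (X1 n) (X3 n) K0 (fun w => uT x (X n w)).
have [N1 N2] := @normal_moment12 R.
have vN3 y : `|v * y| ^+ 3 = v ^+ 3 * `|y| ^+ 3 :> R.
  by rewrite normrM exprMn (gtr0_norm v0).
have ivN3 : N01.-integrable setT (EFin \o (fun y => `|v * y| ^+ 3)).
  rewrite (_ : _ \o _ = (fun y => ((v ^+ 3)%:E * (`|y| ^+ 3)%:E)%E)).
    exact: integrableZl.
  by apply/funext => y; rewrite /= vN3 EFinM.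
have iN1 : N01.-integrable setT (EFin \o (@id R)).
  have := @integrable_normal_moment R 1 0; apply: le_integrable => //.
    by apply/measurable_EFinP; exact: measurable_id.
  by move=> y _; rewrite /= lee_fin mul0r expR0 mulr1 expr1 normr_id.
have iN2 : N01.-integrable setT (EFin \o (fun y : R => y ^+ 2)).
  have := @integrable_normal_moment R 2 0; apply: le_integrable => //.
    by apply/measurable_EFinP; exact: measurable_funX.
  by move=> y _; rewrite /= lee_fin mul0r expR0 mulr1 !normrX normr_id.
have muv : measurable_fun [set: R] (fun y => u (x + v * y)).
  by apply: measurableT_comp => //; exact: measurable_affine.
have mv : measurable_fun [set: R] (fun y => v * y) by exact: measurable_funM.
have v1 : \int[N01]_y (v * y) = 0 by rewrite (RintegralZl v measurableT iN1) N1 mulr0.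
have v3 : \int[N01]_y (`|v * y| ^+ 3) <= v ^+ 3 * beta.
  rewrite -(RintegralZl _ measurableT integrable_N3).
  by rewrite le_eqVlt; apply/orP; left; apply/eqP; apply: eq_Rintegral => y _.
have hN := @Rintegral_taylor _ _ _ N01 (fun y => v * y) (u x) (u1 x) (u2 x) K (v ^+ 3 * beta)
  (fun y => u (x + v * y)) mv muv (fun w => u01 _) ivN3 v1 v3 K0 (fun y => uT x (v * y)).
have v2 : \int[N01]_y ((v * y) ^+ 2) = v ^+ 2.
  transitivity (v ^+ 2 * \int[N01]_y (y ^+ 2)); last by rewrite N2 mulr1.
  rewrite -(RintegralZl _ measurableT iN2).
  by apply: eq_Rintegral => y _; rewrite exprMn.
rewrite X2 in hX; rewrite v2 in hN.
rewrite mulrDr (le_trans _ (lerD hX hN))//.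
rewrite [in leRHS]addrC -[in leLHS]normrN (le_trans _ (ler_normB _ _))// le_eqVlt.
by apply/orP; left; apply/eqP; rewrite /gauss_avg; congr `|_|; ring.
Qed.

(** The invariant of the replacement: [j] original variables remain, and [m] Gaussians are gathered
    in one average of deviation [v * Num.sqrt m%:R]. Each step trades one for the other, which is
    why [m] is generalised in the induction on [j]. *)
Lemma lindeberg_step j m :
  `|\int[P]_w gauss_avg (v * Num.sqrt m%:R) g (partial_sum X j w) -
    gauss_avg (v * Num.sqrt (j + m)%:R) g 0| <= j%:R * (K * (B + v ^+ 3 * beta)).
Proof.
have [mg0 mg1 mg2] := mg.
elim: j m => [|j ih] m.
  rewrite mul0r [X in X - _](_ : _ = gauss_avg (v * Num.sqrt m%:R) g 0) ?subrr ?normr0//.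
  rewrite -[RHS](Rintegral_prob_cst P); apply: eq_Rintegral => w _.
  by rewrite /partial_sum/= big_ord0.
set s := v * Num.sqrt m%:R.
have s0 : 0 <= s by rewrite mulr_ge0 ?sqrtr_ge0// ltW.
have mu := measurable_gauss_avg s mg0 g01.
have u01 := gauss_avg_itv01 s mg0 g01.
have [mXu ->] := Rintegral_partial_sumS j mu u01.
have avgE : gauss_avg (v * Num.sqrt m.+1%:R) g = gauss_avg v (gauss_avg s g).
  apply/funext => x; rewrite gauss_avg_semigroup//; congr (gauss_avg _ g x).
  rewrite /s exprMn sqr_sqrtr// -[X in _ + X]mulr1 -mulrDr -natr1 sqrtrM ?sqr_ge0//.
  by rewrite sqrtr_sqr gtr0_norm// addrC.
have := ih m.+1; rewrite addnS addSn avgE; set z := gauss_avg _ g 0 => ihm.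
have mS : measurable_fun setT (partial_sum X j) by [].
have iu' : P.-integrable setT (EFin \o (fun w => gauss_avg v (gauss_avg s g) (partial_sum X j w))).
  apply: integrable_itv01; last by move=> w; exact: gauss_avg_itv01.
  by apply: measurableT_comp => //; exact: measurable_gauss_avg.
have iuX : P.-integrable setT
    (EFin \o (fun w => \int[P]_w' gauss_avg s g (partial_sum X j w + X j w'))).
  apply: integrable_itv01.
    exact: (measurableT_comp mXu mS).
  move=> w; apply: Rintegral_itv01 => //.
  by apply: measurableT_comp => //; exact: measurable_funD.
rewrite -natr1 mulrDl mul1r.
(* In the middle term the last variable is replaced. Its distance to the left term is bounded
   pointwise in the preceding sum; the rest is the induction hypothesis. *)
apply: (le_trans (ler_distD (\int[P]_w gauss_avg v (gauss_avg s g) (partial_sum X j w)) _ _)).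
rewrite addrC lerD// -(RintegralB measurableT iuX iu').
have iB : P.-integrable setT (EFin \o (fun w =>
    \int[P]_w' gauss_avg s g (partial_sum X j w + X j w') -
    gauss_avg v (gauss_avg s g) (partial_sum X j w))).
  exact: (integrableB measurableT iuX iu').
apply: (le_trans (le_normr_Rintegral measurableT iB)).
rewrite -[leRHS](Rintegral_prob_cst P); apply: le_Rintegral => //.
- exact: (integrable_norm iB).
- exact: finite_measure_integrable_cst.
- by move=> w _; exact: replace_by_gauss.
Qed.

Lemma lindeberg n :
  `|\int[P]_w g (partial_sum X n w) - gauss_avg (v * Num.sqrt n%:R) g 0| <=
  n%:R * (K * (B + v ^+ 3 * beta)).
Proof. by have := lindeberg_step n 0; rewrite sqrtr0 mulr0 gauss_avg0 addn0. Qed.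

End IndependentSum.
End Lindeberg.

(** * Logistic test functions *)

Section Logistic.
Context {R : realType}.

(** Decreasing, so that [logistic (l * (x - b))] smooths the indicator of []-oo, b]], more sharply
    as [l] grows. *)
Definition logistic (x : R) : R := (1 + expR x)^-1.
Let p := logistic.
(** The successive derivatives of [p]: as p' = p^2 - p, each is a polynomial in [p], and a bound by
    1 becomes a polynomial inequality on [[0, 1]]. *)
Let p1 x := p x ^+ 2 - p x.
Let p2 x := 2 * p x ^+ 3 - 3 * p x ^+ 2 + p x.
Let p3 x := (6 * p x ^+ 2 - 6 * p x + 1) * (p x ^+ 2 - p x).

Let den0 x : 0 < 1 + expR x :> R. Proof. by rewrite addr_gt0// expR_gt0. Qed.

Lemma logistic_itv01 x : 0 <= logistic x <= 1.
Proof. by rewrite invr_ge0 ltW//= invf_le1// lerDl expR_ge0. Qed.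

Lemma logistic_noninc x y : x <= y -> logistic y <= logistic x.
Proof. by move=> xy; rewrite lef_pV2 ?posrE// lerD2l ler_expR. Qed.

Lemma logisticN x : logistic (- x) = 1 - logistic x.
Proof.
by rewrite /logistic expRN; field; rewrite !gt_eqF ?expR_gt0// addr_gt0 ?expR_gt0.
Qed.

Lemma logistic_le_inv x : 0 < x -> logistic x <= x^-1.
Proof.
move=> x0; rewrite lef_pV2 ?posrE//.
by have := expR_ge1Dx x; lra.
Qed.

Let dp (x : R) : is_derive x 1 p (p1 x).
Proof.
have d1 : is_derive x 1 (fun y => 1 + expR y : R) (expR x).
  have -> : (fun y : R => 1 + expR y) = cst 1 + expR by [].
  by apply: is_derive_eq; rewrite add0r.
have dV := @is_deriveV _ _ x _ 1 (lt0r_neq0 (den0 x)) d1.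
apply: is_derive_eq; rewrite /p1 /p /logistic /GRing.scale/=; field.
by rewrite gt_eqF.
Qed.

Let dp1 (x : R) : is_derive x 1 p1 (p2 x).
Proof.
have -> : p1 = p * p - p by apply/funext => y; rewrite /p1 expr2.
have d := dp x.
by apply: is_derive_eq; rewrite /p2 /p1 /GRing.scale/=; ring.
Qed.

Let dp2 (x : R) : is_derive x 1 p2 (p3 x).
Proof.
have -> : p2 = 2 \*: (p * p * p) - 3 \*: (p * p) + p.
  by apply/funext => y; rewrite /p2 !exprS expr0 mulr1 -!mulrA.
have d := dp x.
by apply: is_derive_eq; rewrite /p3 /p1 !fctE /GRing.scale/=; ring.
Qed.

Let p1_le1 x : `|p1 x| <= 1.
Proof.
have /andP[] := logistic_itv01 x; rewrite -/(p x) /p1; move: (p x) => q q0 q1.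
by rewrite ler_norml; apply/andP; split; nra.
Qed.

Let p2_le1 x : `|p2 x| <= 1.
Proof.
have /andP[] := logistic_itv01 x; rewrite -/(p x) /p2; move: (p x) => q q0 q1.
have -> : 2 * q ^+ 3 - 3 * q ^+ 2 + q = (2 * q - 1) * (q ^+ 2 - q) by ring.
rewrite normrM mulr_ile1 ?normr_ge0// ler_norml; apply/andP; split; nra.
Qed.

Let p3_le1 x : `|p3 x| <= 1.
Proof.
have /andP[] := logistic_itv01 x; rewrite -/(p x) /p3; move: (p x) => q q0 q1.
rewrite normrM mulr_ile1 ?normr_ge0// ler_norml; apply/andP; split; nra.
Qed.

(** The mean value theorem between 0 and [y]. Giving up the factor 1 / (k + 1) keeps the conclusion
    in the form of the hypothesis, so the lemma can be iterated. *)
Lemma MVT_power_bound (r dr : R -> R) (k : nat) : (forall y : R, is_derive y 1 r (dr y)) ->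
  r 0 = 0 -> (forall y, `|dr y| <= `|y| ^+ k) -> forall y, `|r y| <= `|y| ^+ k.+1.
Proof.
move=> rdr r0 drk y.
have cr A : {within A, continuous r}.
  apply: continuous_subspaceT => z.
  by apply/differentiable_continuous/derivable1_diffP; have [] := rdr z.
have [c cy ry] : exists2 c, `|c| <= `|y| & r y = dr c * y.
  have [y0|y0|->] := ltgtP y 0.
  - have [c] := MVT_segment (ltW y0) (fun x _ => rdr x) (cr _).
    rewrite in_itv/= => /andP[c1 c2]; rewrite r0 !sub0r => ryE.
    exists c; first by rewrite !ler0_norm ?lerN2// ltW.
    by apply: oppr_inj; rewrite ryE mulrN.
  - have [c] := MVT_segment (ltW y0) (fun x _ => rdr x) (cr _).
    rewrite in_itv/= => /andP[c1 c2]; rewrite r0 !subr0 => ryE.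
    by exists c => //; rewrite !ger0_norm// ltW.
  - by exists 0; rewrite // r0 mulr0.
rewrite ry normrM exprSr ler_wpM2r//.
by apply: le_trans (drk c) _; rewrite lerXn2r ?nnegrE.
Qed.

Let taylor2_p : taylor2 1 p p1 (fun x => 2^-1 * p2 x).
Proof.
move=> x y; rewrite mul1r.
have ds (q : R -> R) (dq : R) (z : R) : is_derive (x + z) 1 q dq -> is_derive z 1 (fun y => q (x + y)) dq.
  move=> h; have d1 : is_derive z 1 (fun y : R => x + y) 1.
    have -> : (fun y : R => x + y) = cst x + id by [].
    by apply: is_derive_eq; rewrite add0r.
  by have := @is_derive1_comp R q (fun y => x + y) z _ _ h d1; rewrite mulr1.
(* Each of [r0], [r1], [r2] vanishes at 0 and has the next as its derivative; starting from |p3| <=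
   1, three uses of [MVT_power_bound] reach the cubic bound. *)
pose r0 y := p (x + y) - p x - p1 x * y - 2^-1 * p2 x * y ^+ 2.
pose r1 y := p1 (x + y) - p1 x - p2 x * y.
pose r2 y := p2 (x + y) - p2 x.
have dr0 (z : R) : is_derive z 1 r0 (r1 z).
  have d := ds p _ z (dp (x + z)).
  have -> : r0 = (fun y => p (x + y)) - cst (p x) - p1 x \*: id - (2^-1 * p2 x) \*: (id * id).
    by apply/funext => u; rewrite /r0 expr2.
  by apply: is_derive_eq; rewrite /r1 /GRing.scale/=; field.
have dr1 (z : R) : is_derive z 1 r1 (r2 z).
  have d := ds p1 _ z (dp1 (x + z)).
  have -> : r1 = (fun y => p1 (x + y)) - cst (p1 x) - p2 x \*: id by [].
  by apply: is_derive_eq; rewrite /r2 /GRing.scale/=; ring.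
have dr2 (z : R) : is_derive z 1 r2 (p3 (x + z)).
  have d := ds p2 _ z (dp2 (x + z)).
  have -> : r2 = (fun y => p2 (x + y)) - cst (p2 x) by [].
  by apply: is_derive_eq; rewrite subr0.
apply: (MVT_power_bound dr0); first by rewrite /r0 addr0; ring.
apply: (MVT_power_bound dr1); first by rewrite /r1 addr0; ring.
apply: (MVT_power_bound dr2); first by rewrite /r2 addr0 subrr.
by move=> z; rewrite expr0.
Qed.

Lemma measurable_logistic : measurable_fun [set: R] logistic.
Proof.
apply: continuous_measurable_fun => x.
by apply/differentiable_continuous/derivable1_diffP; have [] := dp x.
Qed.

Lemma logistic_test (l b : R) : 0 < l ->
  exists (g1 g2 : R -> R) (M : R), [/\ measurable_fun [set: R] g1, measurable_fun [set: R] g2,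
    (forall x, `|g1 x| <= M), (forall x, `|g2 x| <= M) &
    taylor2 (l ^+ 3) (fun x => logistic (l * (x - b))) g1 g2].
Proof.
move=> l0; pose a x : R := l * (x - b).
have ma : measurable_fun [set: R] a by apply: measurable_funM => //; exact: measurable_funB.
have mpa : measurable_fun [set: R] (fun x => p (a x)).
  exact: measurableT_comp measurable_logistic ma.
(* The chain rule gives one factor [l] per derivative; [l + l ^+ 2] bounds both functions at
   once. *)
exists (fun x => l * p1 (a x)), (fun x => l ^+ 2 * (2^-1 * p2 (a x))), (l + l ^+ 2); split.
- apply: measurable_funM => //; apply: measurable_funB => //.
  exact: measurable_funX.
- apply: measurable_funM => //; apply: measurable_funM => //.
  apply: measurable_funD => //; apply: measurable_funB; apply: measurable_funM => //.
    exact: measurable_funX.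
  exact: measurable_funX.
- move=> x; rewrite normrM (gtr0_norm l0) ler_wpDr ?sqr_ge0//.
  by apply: ler_piMr; [exact: ltW|exact: p1_le1].
- move=> x; rewrite normrM (ger0_norm (sqr_ge0 _)) ler_wpDl ?(ltW l0)//.
  apply: ler_piMr; first exact: sqr_ge0.
  by rewrite normrM mulr_ile1 ?p2_le1// ger0_norm// invf_le1// ler1n.
- move=> x y; have := taylor2_p (a x) (l * y).
  rewrite mul1r (normrM l y) [_ ^+ 3]exprMn (gtr0_norm l0) => pT.
  rewrite (le_trans _ pT)// le_eqVlt; apply/orP; left; apply/eqP; congr `|_|.
  have -> : l * (x + y - b) = a x + l * y by rewrite /a; ring.
  rewrite -/p /a; ring.
Qed.
End Logistic.

(** * The central limit theorem *)

Section CLT.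
Context {R : realType}.
Local Notation rT := (measurableTypeR R).
Local Notation N01 := (normal_prob (0 : R) 1).

(** Up to [b - e] the logistic function is at least 1 - [logistic (l * e)], and beyond [b + e] at
    most [logistic (l * e)]; in between its values in [[0, 1]] suffice. *)
Lemma logistic_sandwich d (T : measurableType d) (P : probability T R)
    (W : T -> R) (l e b : R) : 0 < l -> 0 < e -> measurable_fun setT W ->
  fine (P [set w | W w <= b - e]) <=
    \int[P]_w logistic (l * (W w - b)) + logistic (l * e) /\
  \int[P]_w logistic (l * (W w - b)) <=
    fine (P [set w | W w <= b + e]) + logistic (l * e).
Proof.
move=> l0 e0 mW.
have mP r : measurable [set w | W w <= r].
  rewrite [X in measurable X](_ : _ = setT `&` W @^-1` `]-oo, r]); first exact: mW.
  by rewrite setTI; apply/seteqP; split => w /=; rewrite in_itv.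
have fP r : fine (P [set w | W w <= r]) = \int[P]_w (\1_[set w | W w <= r] w).
  by rewrite /Rintegral integral_indic// setIT.
have mg : measurable_fun setT (fun w => logistic (l * (W w - b))).
  apply: measurableT_comp; first exact: measurable_logistic.
  by apply: measurable_funM => //; exact: measurable_funB.
have ig : P.-integrable setT (EFin \o (fun w => logistic (l * (W w - b)))).
  by apply: integrable_itv01 => // w; exact: logistic_itv01.
have ic : P.-integrable setT (EFin \o (fun=> logistic (l * e))).
  exact: finite_measure_integrable_cst.
have i1 r : P.-integrable setT (EFin \o (\1_[set w | W w <= r] : T -> R)).
  apply: integrable_itv01; first exact: measurable_indic.
  by move=> w; rewrite indicE; case: (_ \in _); rewrite ?lexx ?ler01.
have le_e z : e <= z -> logistic (l * z) <= logistic (l * e).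
  by move=> ez; apply: logistic_noninc; rewrite ler_pM2l.
have l01 := @logistic_itv01 R.
split.
  rewrite fP -[X in _ <= _ + X](Rintegral_prob_cst P) -(RintegralD measurableT ig ic).
  apply: le_Rintegral => //.
    exact: (integrableD measurableT ig ic).
  move=> w _; rewrite indicE; case: (boolP (w \in _)) => [|_]; last first.
    by rewrite addr_ge0//; have /andP[] := l01 (l * (W w - b)); have /andP[] := l01 (l * e).
  rewrite inE/= => Ww; have := le_e (b - W w); rewrite -opprB mulrN logisticN => H.
  by have := H ltac:(lra); lra.
rewrite fP -[X in _ <= _ + X](Rintegral_prob_cst P).
rewrite -(RintegralD measurableT (i1 (b + e)) ic); apply: le_Rintegral => //.
  exact: (integrableD measurableT (i1 (b + e)) ic).
move=> w _; rewrite indicE; case: (boolP (w \in _)) => [|].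
  have /andP[_ h1] := l01 (l * (W w - b)).
  have /andP[h2 _] := l01 (l * e).
  by move=> _; rewrite ler_wpDr.
rewrite notin_setE/= => /negP; rewrite -ltNge => Ww.
by rewrite add0r le_e//; lra.
Qed.

(** The density is at most its peak, so the distribution function is Lipschitz; this pays for the
    gap between the two thresholds of the sandwich. *)
Lemma normal_cdf_le (a b : R) : a <= b ->
  fine (N01 [set x | x <= b]) <= fine (N01 [set x | x <= a]) + (b - a) * normal_peak 1.
Proof.
move=> ab.
have mS r : measurable ([set x | x <= r] : set rT).
  by rewrite [X in measurable X](_ : _ = `]-oo, r]%classic)//; apply/seteqP; split => w /=; rewrite in_itv.
have -> : [set x | x <= b] = [set x | x <= a] `|` `]a, b]%classic :> set R.
  apply/seteqP; split => x /=; rewrite in_itv/=.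
    by case: (leP x a) => [|ax] xb; [left|right].
  by move=> [xa|/andP[]//]; exact: le_trans ab.
rewrite (@measureU _ _ _ N01)//; last first.
  by apply/seteqP; split => x //= -[]; rewrite in_itv/= => xa /andP[]; rewrite ltNge xa.
rewrite fineD ?fin_num_measure// lerD2l.
rewrite -lee_fin fineK ?fin_num_measure//.
rewrite /normal_prob; apply: (@le_trans _ _ (\int[lebesgue_measure]_(x in `]a, b]) (normal_peak 1)%:E))%E.
  apply: ge0_le_integral => //.
  - by move=> x _; rewrite lee_fin normal_pdf_ge0.
  - by apply/measurable_EFinP/measurable_funTS; exact: measurable_normal_pdf.
  - by move=> x _; rewrite lee_fin normal_pdf_ub ?oner_eq0.
rewrite integral_cst//= lebesgue_measure_itv/= lte_fin.
case: ifPn => _; last by rewrite mule0 lee_fin mulr_ge0 ?subr_ge0 ?normal_peak_ge0.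
by rewrite -EFinB -EFinM lee_fin mulrC.
Qed.

Section NormalizedSums.
Context {d : measure_display} {T : measurableType d}.
Variables (P : probability T R) (Y : nat -> {RV P >-> R}).

Lemma mutually_independent_affine (a b : R) (X : nat -> {RV P >-> R}) :
  (forall i w, X i w = a * (Y i w - b)) ->
  mutually_independent Y -> mutually_independent X.
Proof.
move=> XE indepY J A mA.
have mF : measurable_fun [set: R] (fun y : R => a * (y - b)).
  by apply: measurable_funM => //; exact: measurable_funB.
have mA' i : measurable ((fun y => a * (y - b)) @^-1` A i) by rewrite -[X in measurable X]setTI; exact: mF.
have XA i : X i @^-1` A i = Y i @^-1` ((fun y => a * (y - b)) @^-1` A i).
  by apply/seteqP; split => w /=; rewrite XE.
rewrite (_ : \bigcap_(i in [set` J]) (X i @^-1` A i) =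
  \bigcap_(i in [set` J]) (Y i @^-1` ((fun y => a * (y - b)) @^-1` A i))).
  by rewrite indepY//; apply: eq_bigr => i _; rewrite XA.
by apply: eq_bigcapr => i _; rewrite XA.
Qed.

Variables (m s B : R).
Hypothesis indepY : mutually_independent Y.
Hypothesis s0 : 0 < s.
Hypothesis iY : forall n, P.-integrable setT (fun w => (`|Y n w - m| ^+ 3)%:E).
Hypothesis iY1 : forall n, P.-integrable setT (fun w => (Y n w - m)%:E).
Hypothesis iY2 : forall n, P.-integrable setT (fun w => ((Y n w - m) ^+ 2)%:E).
Hypothesis Y1 : forall n, \int[P]_w (Y n w - m) = 0.
Hypothesis Y2 : forall n, \int[P]_w ((Y n w - m) ^+ 2) = s ^+ 2.
Hypothesis Y3 : forall n, \int[P]_w (`|Y n w - m| ^+ 3) <= B.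

Let Z n w := (\sum_(i < n) Y i w - n%:R * m) / Num.sqrt (n%:R * s ^+ 2).
Let beta := \int[N01]_y (`|y| ^+ 3).

Lemma measurable_normalized_sum n : measurable_fun setT (Z n).
Proof.
apply: measurable_funM => //; apply: measurable_funB => //.
exact: measurable_partial_sum.
Qed.

(** The centred variables are divided by [s * q], so that [v = q^-1] and [n] steps end in a unit
    Gaussian. The [n] errors of order q^-3 add up to order q^-1, as n = q^2. *)
Lemma logistic_normalized_sum (l b : R) n : 0 < l -> (0 < n)%N ->
  `|\int[P]_w logistic (l * (Z n w - b)) - \int[N01]_x logistic (l * (x - b))| <=
  l ^+ 3 * (B / s ^+ 3 + beta) / Num.sqrt n%:R.
Proof.
move=> l0 n0; set q := Num.sqrt n%:R.
have q0 : 0 < q by rewrite sqrtr_gt0 ltr0n.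
have q2 : q ^+ 2 = n%:R by rewrite sqr_sqrtr.
have sq0 : 0 < (s * q)^-1 by rewrite invr_gt0 mulr_gt0.
pose X0 i w := (s * q)^-1 * (Y i w - m).
have mX0 i : measurable_fun setT (X0 i).
  by apply: measurable_funM => //; exact: measurable_funB.
pose X i : {RV P >-> R} := HB.pack (X0 i) (isMeasurableFun.Build _ _ _ _ _ (mX0 i)).
have XE i w : X i w = (s * q)^-1 * (Y i w - m) by [].
have ZE w : Z n w = partial_sum X n w.
  rewrite /Z /partial_sum/= /X0 -mulr_sumr sumrB sumr_const card_ord.
  by rewrite sqrtrM// sqrtr_sqr (gtr0_norm s0) -/q mulr_natl [LHS]mulrC [q * s]mulrC.
have [g1 [g2 [M [mg1 mg2 g1M g2M gT]]]] := logistic_test b l0.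
have mg : measurable_fun [set: R] (fun x => logistic (l * (x - b))).
  apply: measurableT_comp; first exact: measurable_logistic.
  by apply: measurable_funM => //; exact: measurable_funB.
have X3E i w : `|X i w| ^+ 3 = (s * q) ^- 3 * `|Y i w - m| ^+ 3.
  by rewrite XE normrM exprMn (gtr0_norm sq0) exprVn.
have c3 : 0 <= (s * q) ^- 3 by rewrite invr_ge0 exprn_ge0// mulr_ge0// ltW.
have iX i : P.-integrable setT (fun w => (`|X i w| ^+ 3)%:E).
  rewrite (_ : (fun _ => _) = (fun w => ((s * q) ^- 3)%:E * (`|Y i w - m| ^+ 3)%:E)%E).
    exact: integrableZl.
  by apply/funext => w; rewrite X3E EFinM.
have X1 i : \int[P]_w X i w = 0 by rewrite (RintegralZl _ measurableT (iY1 i)) Y1 mulr0.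
have X2 i : \int[P]_w (X i w ^+ 2) = q^-1 ^+ 2.
  transitivity ((s * q)^-1 ^+ 2 * \int[P]_w ((Y i w - m) ^+ 2)).
    rewrite -(RintegralZl _ measurableT (iY2 i)); apply: eq_Rintegral => w _.
    by rewrite XE exprMn.
  by rewrite Y2; field; rewrite !gt_eqF.
have X3 i : \int[P]_w (`|X i w| ^+ 3) <= (s * q) ^- 3 * B.
  rewrite (_ : \int[P]_w _ = (s * q) ^- 3 * \int[P]_w (`|Y i w - m| ^+ 3)).
    by rewrite ler_wpM2l.
  rewrite -(RintegralZl _ measurableT (iY i)); apply: eq_Rintegral => w _.
  by rewrite X3E.
have l3 : 0 <= l ^+ 3 by rewrite exprn_ge0// ltW.
have iq0 : 0 < q^-1 by rewrite invr_gt0.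
have := @lindeberg R _ _ P X (mutually_independent_affine XE indepY) (l ^+ 3) M q^-1
  ((s * q) ^- 3 * B) _ g1 g2 (And3 mg mg1 mg2) (fun x => logistic_itv01 _) g1M g2M
  l3 gT iq0 iX X1 X2 X3 n.
rewrite -/q mulVf ?gt_eqF//.
rewrite (_ : gauss_avg 1 _ 0 = \int[N01]_x logistic (l * (x - b))); last first.
  by apply: eq_Rintegral => x _; rewrite mul1r add0r.
rewrite (_ : \int[P]_w logistic (l * (partial_sum X n w - b)) =
    \int[P]_w logistic (l * (Z n w - b))); last first.
  by apply: eq_Rintegral => w _; rewrite ZE.
move=> H; apply: (le_trans H); rewrite -q2 le_eqVlt; apply/orP; left; apply/eqP.
by rewrite -/beta; field; rewrite !gt_eqF.
Qed.

Theorem normalized_sum_clt (a : R) :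
  P [set w | Z n w <= a] @[n --> \oo] --> N01 `]-oo, a].
Proof.
have fN (Q : probability rT R) r : Q `]-oo, r]%classic = Q [set x | x <= r].
  by congr (Q _); apply/seteqP; split => x /=; rewrite in_itv.
have mZ r n : measurable [set w | Z n w <= r].
  rewrite [X in measurable X](_ : _ = setT `&` Z n @^-1` `]-oo, r]).
    exact: measurable_normalized_sum.
  by rewrite setTI; apply/seteqP; split => w /=; rewrite in_itv.
rewrite -[N01 _]fineK ?fin_num_measure//; apply/fine_cvgP; split.
  by apply: nearW => n; rewrite fin_num_measure.
apply/cvgrPdist_le => e e0.
pose k : R := normal_peak 1.
have k0 : 0 < k by rewrite normal_peak_gt0 ?oner_eq0.
(* The budget: twice [e / 8] for the tails of the logistic function, [e / 4] for the replacement,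
   and [e / 4] for moving the Gaussian threshold by [2 * dl] at cost [k] per unit length. The choice
   of [l] makes the tail bound 1 / (l dl) equal to [e / 8]. *)
pose dl := e / (8 * k).
have dl0 : 0 < dl by rewrite divr_gt0// mulr_gt0.
pose l := 8 / (e * dl).
have l0 : 0 < l by rewrite divr_gt0// mulr_gt0.
have ple : logistic (l * dl) <= e / 8.
  apply: (le_trans (logistic_le_inv (mulr_gt0 l0 dl0))); rewrite le_eqVlt.
  by apply/orP; left; apply/eqP; rewrite /l; field; rewrite !gt_eqF.
pose D := l ^+ 3 * (B / s ^+ 3 + beta).
near=> n.
have n0 : (0 < n)%N by near: n; exact: nbhs_infty_gt.
have Dn : D / Num.sqrt n%:R <= e / 4.
  have q0 : 0 < Num.sqrt n%:R :> R by rewrite sqrtr_gt0 ltr0n.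
  have e4 : 0 < e / 4 by rewrite divr_gt0.
  (* The sign of [D] is not established, hence the norm; the condition on [n] becomes n >= (D / (e /
     4))^2. *)
  rewrite ler_pdivrMr// mulrC -ler_pdivrMr// (le_trans (ler_norm _))//.
  rewrite -(sqrtr_sqr (D / (e / 4))) ler_wsqrtr//.
  by near: n; exact: nbhs_infty_ger.
rewrite /= fN distrC ler_distl.
have mid := @measurable_id _ rT setT.
have mZn := measurable_normalized_sum n.
have kd : (2 * dl) * k = e / 4 by rewrite /dl; field; rewrite gt_eqF.
(* Centring at [a + dl] puts the lower threshold at [a], and centring at [a - dl] the upper one; the
   opposite thresholds are then [2 * dl] away from [a]. *)
have [U1 _] := logistic_sandwich P (a + dl) l0 dl0 mZn.
have [_ U2] := logistic_sandwich N01 (a + dl) l0 dl0 mid.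
have U3 := logistic_normalized_sum (a + dl) l0 n0.
have U4 : fine (N01 [set x | x <= a + dl + dl]) <= fine (N01 [set x | x <= a]) + e / 4.
  have -> : a + dl + dl = a + 2 * dl by ring.
  rewrite (_ : e / 4 = (a + 2 * dl - a) * k); last by rewrite -kd; ring.
  by apply: normal_cdf_le; rewrite lerDl mulr_ge0// ltW.
have [_ L1] := logistic_sandwich P (a - dl) l0 dl0 mZn.
have [L2 _] := logistic_sandwich N01 (a - dl) l0 dl0 mid.
have L3 := logistic_normalized_sum (a - dl) l0 n0.
have L4 : fine (N01 [set x | x <= a]) <= fine (N01 [set x | x <= a - dl - dl]) + e / 4.
  have -> : a - dl - dl = a - 2 * dl by ring.
  rewrite (_ : e / 4 = (a - (a - 2 * dl)) * k); last by rewrite -kd; ring.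
  by apply: normal_cdf_le; rewrite gerDl oppr_le0 mulr_ge0// ltW.
rewrite addrK in U1; rewrite subrK in L1.
move: (le_trans U3 Dn) (le_trans L3 Dn); rewrite !ler_norml => /andP[U5 U6] /andP[L5 L6].
by apply/andP; split; lra.
Unshelve. all: by end_near.
Qed.
End NormalizedSums.
End CLT.

(** * Expectations of functions of a variable with a density *)

Section DensityExpectation.
Context {R : realType} {d : measure_display} {T : measurableType d}.
Local Notation mu := (@lebesgue_measure R).
Variables (P : probability T R) (Y : {RV P >-> R}) (h : R -> R).
Hypothesis ih : mu.-integrable setT (EFin \o h).
Hypothesis Yh : has_density Y h.

Let ge0_density (F : R -> R) : measurable_fun [set: R] F -> (forall x, 0 <= F x) ->
  mu.-integrable setT (EFin \o (fun x => F x * h x)) ->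
  P.-integrable setT (EFin \o (F \o Y)) /\
  \int[P]_w F (Y w) = \int[mu]_x (F x * h x).
Proof.
move=> mF F0 iF.
have H : (\int[P]_w (F (Y w))%:E = \int[mu]_x (F x * h x)%:E)%E.
  (* Lebesgue measure lives on [measurableTypeR R], so [Y] is retyped with that codomain before
     integrals are transported. *)
  have mY : measurable_fun setT (Y : T -> measurableTypeR R).
    by move=> _ A mA; rewrite setTI; exact: (measurable_funPTI Y).
  pose Y' : {mfun T >-> measurableTypeR R} := HB.pack (Y : T -> measurableTypeR R)
    (isMeasurableFun.Build _ _ _ _ _ mY).
  have F0' x : (0 <= (EFin \o F) x)%E by rewrite lee_fin.
  have mF' : measurable_fun [set: measurableTypeR R] (EFin \o F).
    exact/measurable_EFinP.
  rewrite -(@ge0_integral_density _ (measurableTypeR R) R mu (distribution P Y') h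
    (EFin \o F) ih Yh mF' F0').
  by rewrite ge0_integral_distribution.
split; last by rewrite /Rintegral H.
apply/integrableP; split; first by apply/measurable_EFinP; exact: measurableT_comp.
under eq_integral do rewrite /= ger0_norm//.
by rewrite H ltey_eq (integrable_fin_num measurableT iF).
Qed.

(** Positive and negative parts reduce the claim to nonnegative functions; both are dominated by
    |F|, so they inherit integrability against [h]. *)
Lemma Rintegral_has_density (F : R -> R) : measurable_fun [set: R] F ->
  mu.-integrable setT (EFin \o (fun x => F x * h x)) ->
  P.-integrable setT (EFin \o (F \o Y)) /\
  \int[P]_w F (Y w) = \int[mu]_x (F x * h x).
Proof.
move=> mF iF.
have mh : measurable_fun [set: R] h by apply/measurable_EFinP; exact: measurable_int ih.
pose Fp x := (`|F x| + F x) / 2; pose Fn x := (`|F x| - F x) / 2.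
have mFp : measurable_fun [set: R] Fp.
  apply: measurable_funM => //; apply: measurable_funD => //.
  exact: measurableT_comp (@normr_measurable R setT) mF.
have mFn : measurable_fun [set: R] Fn.
  apply: measurable_funM => //; apply: measurable_funB => //.
  exact: measurableT_comp (@normr_measurable R setT) mF.
have FE x : F x = Fp x - Fn x by rewrite /Fp /Fn; field.
have Fp0 x : 0 <= Fp x.
  by rewrite divr_ge0//; have := ler_norm (- F x); rewrite normrN; lra.
have Fn0 x : 0 <= Fn x by rewrite divr_ge0// subr_ge0 ler_norm.
have le_abs x : Fp x + Fn x = `|F x| by rewrite /Fp /Fn; field.
have iFp : mu.-integrable setT (EFin \o (fun x => Fp x * h x)).
  apply: le_integrable iF => //; first by apply/measurable_EFinP; exact: measurable_funM.
  move=> x _; rewrite /= lee_fin (normrM (Fp x)) (normrM (F x)) ler_wpM2r//.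
  by rewrite (ger0_norm (Fp0 x)) -le_abs lerDl.
have iFn : mu.-integrable setT (EFin \o (fun x => Fn x * h x)).
  apply: le_integrable iF => //; first by apply/measurable_EFinP; exact: measurable_funM.
  move=> x _; rewrite /= lee_fin (normrM (Fn x)) (normrM (F x)) ler_wpM2r//.
  by rewrite (ger0_norm (Fn0 x)) -le_abs lerDr.
have [jp ep] := ge0_density mFp Fp0 iFp.
have [jn en] := ge0_density mFn Fn0 iFn.
have -> : F = fun x => Fp x - Fn x by apply/funext.
split; first exact: (integrableB measurableT jp jn).
rewrite (RintegralB measurableT jp jn) ep en -(RintegralB measurableT iFp iFn).
by apply: eq_Rintegral => x _; rewrite mulrBl.
Qed.
End DensityExpectation.

Theorem theorem8p11 (R : realType) (f phi : R -> R)
  (f_L1 : f \in Lfun (@lebesgue_measure R) 1%E)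
  (f_ge0 : {ae (@lebesgue_measure R), forall x, 0 <= f x})
  (phi_schwartz : schwartz phi)
  (phi_ge0 : forall x, 0 <= phi x)
  (f_phi : (\int[@lebesgue_measure R]_x (f x * phi x)%:E = 1)%E)
  (kappa2_gt0 : 0 < weak_cumulant (regular_distribution f) phi 2) :
  let h : R -> R := fun x => phi x * f x in
  let kappa : nat -> R[i] := weak_cumulant (regular_distribution f) phi in
  [/\ probability_density h /\ (forall k : nat, finite_moment h k),
      (density_mean h)%:C = kappa 1%N /\ (density_variance h)%:C = kappa 2%N,
      (forall t : R, char_fun h t = weak_cf (regular_distribution f) phi t) &
      (forall (d : measure_display) (T : measurableType d)
              (P : probability T R) (Y : nat -> {RV P >-> R}),
         mutually_independent Y ->
         (forall i, has_density (Y i) h) ->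
         let Z (n : nat) (w : T) : R :=
           (\sum_(i < n) Y i w - n%:R * complex.Re (kappa 1%N)) /
           Num.sqrt (n%:R * complex.Re (kappa 2%N)) in
         forall a : R,
           P [set w | Z n w <= a] @[n --> \oo] --> normal_prob 0 1 `]-oo, a])].
Proof.
move=> h kappa.
have ih k : finite_moment h k by exact: finite_moment_schwartz.
have h1 : (\int[lebesgue_measure]_x (h x)%:E = 1)%E.
  by rewrite -f_phi; apply: eq_integral => x _; rewrite mulrC.
have ih0 : (@lebesgue_measure R).-integrable setT (EFin \o h).
  by have := ih 0%N; congr (_.-integrable _ _); apply/funext => x; rewrite expr0 mul1r.
have mh : measurable_fun [set: R] h by apply/measurable_EFinP; exact: measurable_int ih0.
have [k1 k2] := weak_cumulants_of_density ih h1 kappa2_gt0.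
split => //.
- split=> //; split => //.
  by apply: negligibleS f_ge0 => x /= nh fx; apply: nh; rewrite mulr_ge0.
- by move=> t; exact: char_fun_weak_cf.
move=> d T P Y indepY Yh Z a.
set m := density_mean h in k1.
have v0 : 0 < density_variance h by move: kappa2_gt0; rewrite -k2 ltcR.
pose s := Num.sqrt (density_variance h).
have s0 : 0 < s by rewrite sqrtr_gt0.
have s2 : s ^+ 2 = density_variance h by rewrite sqr_sqrtr// ltW.
have mB : measurable_fun [set: R] (fun x => x - m) by exact: measurable_funB.
have i1 : (@lebesgue_measure R).-integrable setT (EFin \o (fun x => (x - m) * h x)).
  have := integrableB measurableT (ih 1%N) (integrableZl measurableT m ih0).
  by congr (_.-integrable _ _); apply/funext => x; rewrite /= expr1 mulrBl.
have i2 : (@lebesgue_measure R).-integrable setT (EFin \o (fun x => (x - m) ^+ 2 * h x)).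
  have := integrableD measurableT (integrableB measurableT (ih 2%N)
    (integrableZl measurableT (2 * m) (ih 1%N))) (integrableZl measurableT (m ^+ 2) ih0).
  by congr (_.-integrable _ _); apply/funext => x; rewrite /=; congr EFin; ring.
(* Domination by |x - m|^3 <= (|x| + |m|)^3 <= 4 (|x|^3 + |m|^3); with p = |x| and q = |m| the last
   gap is 3 (p + q) (p - q)^2. *)
have i3 : (@lebesgue_measure R).-integrable setT (EFin \o (fun x => `|x - m| ^+ 3 * h x)).
  have := integrableD measurableT (integrable_norm (integrableZl measurableT 4 (ih 3%N)))
    (integrable_norm (integrableZl measurableT (4 * `|m| ^+ 3) ih0)).
  apply: le_integrable => //.
    apply/measurable_EFinP; apply: measurable_funM => //; apply: measurable_funX.
    exact: measurableT_comp (@normr_measurable R setT) mB.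
  move=> x _; rewrite /= lee_fin [leRHS]ger0_norm ?addr_ge0//.
  rewrite (normrM (`|x - m| ^+ 3)) (normrM 4 (x ^+ 3 * h x)) (normrM (x ^+ 3)).
  rewrite (normrM (4 * `|m| ^+ 3)) (normrM 4 (`|m| ^+ 3)) !normrX !normr_id.
  rewrite (ger0_norm (ler0n R 4)) mulrA -mulrDl ler_wpM2r//.
  have := ler_normB x m; have := normr_ge0 (x - m).
  have := normr_ge0 x; have := normr_ge0 m.
  move: `|x| `|m| `|x - m| => p q r q0 p0 r0 rpq.
  apply: (@le_trans _ _ ((p + q) ^+ 3)); first by rewrite lerXn2r ?nnegrE ?addr_ge0.
  rewrite -subr_ge0 (_ : _ - _ = 3 * (p + q) * (p - q) ^+ 2); last by ring.
  by rewrite mulr_ge0 ?sqr_ge0// mulr_ge0// addr_ge0.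
have m3 : measurable_fun [set: R] (fun x => `|x - m| ^+ 3).
  by apply: measurable_funX; exact: measurableT_comp (@normr_measurable R setT) mB.
have m2 : measurable_fun [set: R] (fun x => (x - m) ^+ 2) by exact: measurable_funX.
have E1 n := Rintegral_has_density ih0 (Yh n) mB i1.
have E2 n := Rintegral_has_density ih0 (Yh n) m2 i2.
have E3 n := Rintegral_has_density ih0 (Yh n) m3 i3.
have mean0 : \int[lebesgue_measure]_x ((x - m) * h x) = 0.
  transitivity (\int[lebesgue_measure]_x (x * h x - m * h x)).
    by apply: eq_Rintegral => x _; rewrite mulrBl.
  have i0 : (@lebesgue_measure R).-integrable setT (EFin \o (fun x => x * h x)).
    by have := ih 1%N; congr (_.-integrable _ _); apply/funext => x; rewrite expr1.
  have im : (@lebesgue_measure R).-integrable setT (EFin \o (fun x => m * h x)).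
    exact: (integrableZl measurableT m ih0).
  rewrite (RintegralB measurableT i0 im) (RintegralZl m measurableT ih0).
  by rewrite [X in _ - _ * X]/Rintegral h1 mulr1 subrr.
(* All variables share the density [h], so its third absolute central moment serves as a common
   [B]. *)
have := @normalized_sum_clt R d T P Y m s (\int[lebesgue_measure]_x (`|x - m| ^+ 3 * h x))
  indepY s0 (fun n => (E3 n).1) (fun n => (E1 n).1) (fun n => (E2 n).1)
  (fun n => etrans (E1 n).2 mean0) (fun n => etrans (E2 n).2 (esym s2)) _ a.
rewrite /Z -[kappa 1%N]k1 -[kappa 2%N]k2 /= -s2; apply.
by move=> n; rewrite (E3 n).2.
Qed.
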